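(* Let $q=2^f$ with $f\ge1$, let $\mathcal{S}=\{\alpha_1,\alpha_2,\alpha_3,\alpha_4,\alpha_5,\alpha_6,\alpha_7,\alpha_8,\alpha_9,\alpha_{10},\alpha_{11},\alpha_{16}\}$ and $\mathcal{Z}=\{\alpha_8,\alpha_{10},\alpha_{11},\alpha_{16}\}$ (positive roots of type $\mathrm{F}_4$), and let $\mathcal{F}_{7,2}=\mathrm{Irr}(X_{\mathcal{S}})_{\mathcal{Z}}$. Then $$\mathcal{F}_{7,2}=\bigsqcup_{i=1}^8\mathcal{F}_{7,2}^i,$$ where $\mathcal{F}_{7,2}^1$ consists of $8(q-1)^4$ irreducible characters of degree $q^4/8$, and each of $\mathcal{F}_{7,2}^i$ for $i\in\{2,\dots,8\}$ consists of $2(q-1)^4$ irreducible characters of degree $q^4/4$.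
   Context: Let $U=\mathrm{UF}_4(q)$, $q=2^f$, be the Sylow $2$-subgroup of the Chevalley group $\mathrm{F}_4(q)$ that is the product of the root subgroups $X_\alpha=\{x_\alpha(t)\mid t\in\mathbb{F}_q\}$, $\alpha\in\Phi^+$, where $\Phi^+$ is the set of $24$ positive roots of $\mathrm{F}_4$, the $x_\alpha:(\mathbb{F}_q,+)\to U$ are injective homomorphisms, and the Chevalley commutator relations $[x_\alpha(t),x_\beta(s)]=\prod_{i,j>0,\ i\alpha+j\beta\in\Phi^+}x_{i\alpha+j\beta}(c_{i,j}^{\alpha,\beta}(-s)^jt^i)$ hold, with $c_{i,j}^{\alpha,\beta}$ the Chevalley structure constants reduced modulo $2$. Labelling of roots: the simple roots are $\alpha_1,\alpha_2$ (long) and $\alpha_3,\alpha_4$ (short), with Dynkin diagram $\alpha_1-\alpha_2\Rightarrow\alpha_3-\alpha_4$. Writing $abcd$ for $a\alpha_1+b\alpha_2+c\alpha_3+d\alpha_4$: $\alpha_5=1100$, $\alpha_6=0110$, $\alpha_7=0011$, $\alpha_8=1110$, $\alpha_9=0120$, $\alpha_{10}=0111$, $\alpha_{11}=1120$, $\alpha_{16}=0122$. For $\mathcal{T}\subseteq\Phi^+$, $X_{\mathcal{T}}$ denotes the set of products $\prod_{\alpha\in\mathcal{T}}x_\alpha(t_\alpha)$ with $t_\alpha\in\mathbb{F}_q$, taken in an order of non-decreasing height. Let $\mathcal{K}=\Phi^+\setminus\mathcal{S}$. Then (as $q$ is even) $X_{\mathcal{K}}$ is a normal subgroup of $U$, and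 $X_{\mathcal{S}}:=U/X_{\mathcal{K}}$, a group of order $q^{12}$; images of root subgroups $X_\alpha$ ($\alpha\in\mathcal{S}$) in $X_{\mathcal{S}}$ are again denoted $X_\alpha$. One has $X_\gamma\subseteq Z(X_{\mathcal{S}})$ for $\gamma\in\mathcal{Z}$. $\mathrm{Irr}(X_{\mathcal{S}})_{\mathcal{Z}}$ is the set of irreducible complex characters $\chi$ of $X_{\mathcal{S}}$ such that $X_\gamma\not\subseteq\ker\chi$ for every $\gamma\in\mathcal{Z}$. *)

(* Defs.v *)
From HB Require Import structures.
From mathcomp Require Import all_boot all_order all_algebra all_fingroup.
From mathcomp Require Import all_solvable all_field all_character.

Set Implicit Arguments.
Unset Strict Implicit.
Unset Printing Implicit Defensive.

Import GRing.Theory.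
Local Open Scope ring_scope.

(* Roots of F4 are written in coordinates with respect to the simple roots    *)
(* alpha_1, alpha_2 (long), alpha_3, alpha_4 (short), with Dynkin diagram     *)
(* alpha_1 - alpha_2 => alpha_3 - alpha_4.                                    *)
Definition rootF4 := seq int.

Definition radd (u v : rootF4) : rootF4 := [seq x.1 + x.2 | x <- zip u v].
Definition rscale (m : int) (u : rootF4) : rootF4 := [seq m * x | x <- u].
Definition ropp (u : rootF4) : rootF4 := rscale (-1) u.

(* The Weyl-invariant form, scaled so that (a, a) = 4 for a long root a and   *)
(* (a, a) = 2 for a short one.                                                *)
Definition ip (u v : rootF4) : int :=
    4 * (u`_0 * v`_0) + 4 * (u`_1 * v`_1)
  + 2 * (u`_2 * v`_2) + 2 * (u`_3 * v`_3)
  - 2 * (u`_0 * v`_1 + u`_1 * v`_0)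
  - 2 * (u`_1 * v`_2 + u`_2 * v`_1)
  - (u`_2 * v`_3 + u`_3 * v`_2).

(* In order of non-decreasing height; the entry at position i - 1 is alpha_i. *)
Definition posrootsF4 : seq rootF4 :=
  [:: [:: 1; 0; 0; 0]; [:: 0; 1; 0; 0]; [:: 0; 0; 1; 0]; [:: 0; 0; 0; 1];
      [:: 1; 1; 0; 0]; [:: 0; 1; 1; 0]; [:: 0; 0; 1; 1];
      [:: 1; 1; 1; 0]; [:: 0; 1; 2; 0]; [:: 0; 1; 1; 1];
      [:: 1; 1; 2; 0]; [:: 1; 1; 1; 1]; [:: 0; 1; 2; 1];
      [:: 1; 2; 2; 0]; [:: 1; 1; 2; 1]; [:: 0; 1; 2; 2];
      [:: 1; 2; 2; 1]; [:: 1; 1; 2; 2];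
      [:: 1; 2; 3; 1]; [:: 1; 2; 2; 2];
      [:: 1; 2; 3; 2];
      [:: 1; 2; 4; 2];
      [:: 1; 3; 4; 2];
      [:: 2; 3; 4; 2]].

Definition rootsF4 : seq rootF4 := posrootsF4 ++ [seq ropp a | a <- posrootsF4].

Definition alpha (i : nat) : rootF4 := nth [::] posrootsF4 i.-1.

(* <a, b^v> = 2 (a, b) / (b, b) *)
Definition cartan (a b : rootF4) : int := ((2 * ip a b) %/ ip b b)%Z.

(* The coefficient of the j-th simple coroot in the coroot of a.              *)
Definition corootc (a : rootF4) (j : nat) : int :=
  ((a`_j.-1 * ip (alpha j) (alpha j)) %/ ip a a)%Z.

(* The largest p such that b, b - a, ..., b - p a are all roots (p <= 2).     *)
Definition strp (a b : rootF4) : nat :=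
  find (fun k : nat => radd b (rscale (- k.+1%:Z) a) \notin rootsF4) (iota 0 4).

(* Chevalley basis of the Lie algebra of type F4: inl a stands for the root   *)
(* vector e_a and inr j for h_j, the coroot of alpha_j.                       *)
Definition chevbasis : seq (rootF4 + nat) :=
  [seq inl a | a <- rootsF4] ++ [seq inr j | j <- iota 1 4].

(* The coefficient of r in (ad e_a)^k / k! applied to c, for c and r in the   *)
(* Chevalley basis, so that x_a(t) = exp (t ad e_a) acts by                   *)
(*   x_a(t) e_a      = e_a,                                                   *)
(*   x_a(t) e_(-a)   = e_(-a) + t h_a - t^2 e_a,                              *)
(*   x_a(t) h_j      = h_j - <a, alpha_j^v> t e_a,                            *)
(*   x_a(t) e_b      = \sum_k (+/-) 'C(p + k, k) t^k e_(b + k a), b <> a, -a, *)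
(* with p = strp a b (Carter, Simple groups of Lie type, section 4.4).  The   *)
(* signs (+/-) depend on the choice of the Chevalley basis; they are dropped  *)
(* because these matrices are only used over fields of characteristic 2.      *)
Definition adpow (a : rootF4) (k : nat) (c r : rootF4 + nat) : int :=
  if k == 0%N then (r == c)%:R else
  match c, r with
  | inl b, inl d =>
      if b == ropp a then (if (k == 2%N) && (d == a) then -1 else 0)
      else if d == radd b (rscale k%:Z a) then 'C(strp a b + k, k)%:Z else 0
  | inl b, inr j => if (k == 1%N) && (b == ropp a) then corootc a j else 0
  | inr j, inl d => if (k == 1%N) && (d == a) then - cartan a (alpha j) else 0
  | inr _, inr _ => 0
  end.

Section UF4.

(* All constructions below are meant for F of characteristic 2.               *)
Variable F : finFieldType.

(* The matrix of x_a(t) acting on column vectors; (ad e_a)^3 / 3! = 0 in F4.  *)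
Definition xmat (a : rootF4) (t : F) : 'M[F]_52 :=
  \matrix_(i, j) \sum_(k < 3)
     (adpow a k (nth (inr 0%N) chevbasis j) (nth (inr 0%N) chevbasis i))%:~R
       * t ^+ k.

Definition rootsubg (a : rootF4) : {set {'GL_52[F]}} :=
  [set g : {'GL_52[F]} | [exists t : F, GLval g == xmat a t]].

(* The (adjoint) Chevalley group F4(q) and its subgroup U = UF4(q).           *)
Definition chevF4 : {group {'GL_52[F]}} :=
  <<\bigcup_(a <- rootsF4) rootsubg a>>%G.

Definition UF4 : {group {'GL_52[F]}} :=
  <<\bigcup_(a <- posrootsF4) rootsubg a>>%G.

Definition labS : seq nat := [:: 1; 2; 3; 4; 5; 6; 7; 8; 9; 10; 11; 16]%N.
Definition labZ : seq nat := [:: 8; 10; 11; 16]%N.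
Definition labK : seq nat := [seq i <- iota 1 24 | i \notin labS].

(* A pointwise product of subsets, in order of non-decreasing height.         *)
Definition XK : {set {'GL_52[F]}} :=
  (\prod_(i <- labK) rootsubg (alpha i))%g.

Definition XS : {group coset_of XK} := (UF4 / XK)%G.

Definition F72 : {set Iirr XS} :=
  [set c : Iirr XS |
     all (fun i => ~~ ((rootsubg (alpha i) / XK)%g \subset cfker 'chi_c)) labZ].

End UF4.

(* Main.v *)
Require Import Defs.
From HB Require Import structures.
From mathcomp Require Import all_boot all_order all_algebra all_fingroup.
From mathcomp Require Import all_solvable all_field all_character.
From mathcomp Require Import ring.

Set Implicit Arguments.
Unset Strict Implicit.
Unset Printing Implicit Defensive.

Import Order.TTheory GRing.Theory Num.Theory.
Local Open Scope ring_scope.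

(** Write q for the order of F, and x_i(t) for the root elements modulo X_K.

The group.  In characteristic 2 the commutators of two short root elements
whose roots add up to a long root vanish, and the relations left in X_S are
[x_1,x_2] = x_5, [x_1,x_6] = x_8, [x_1,x_9] = x_11, [x_2,x_3] = x_6 x_9,
[x_2,x_7] = x_10 x_16, [x_5,x_3] = x_8 x_11, [x_3,x_4] = x_7, [x_4,x_6] = x_10
and [x_9,x_4] = x_16, where x_9, x_11 and x_16 carry a square when the left
hand side is a short root against a long one.  They are read off the 52 by 52
matrices: the entries of x_i(t) are polynomials in t, so an identity between
products of such matrices is a finite check on monomials ([xg_comm]).  Unique
factorization, hence the order q^12 of X_S, comes from the action on the Borel
subalgebra: x_k(t) sends some h_j to h_j + t e_k + ..., and the factors that
follow it in the product do not disturb the coordinate along e_k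
([separated_group], [XS_structure]).

The characters.  M = X_5 X_6 X_7 X_9 X_8 X_10 X_11 X_16 is an elementary abelian
normal subgroup of order q^8, with X_8, X_10, X_11, X_16 central in X_S.  Its
characters are psi_b(m(v)) = phi(<b,v>), for b in F^8 and phi the additive
character given by the trace to the field with two elements.  An element
x_1(t_1) x_4(t_4) x_2(t_2) x_3(t_3) fixes psi_b when four additive polynomials in
t_1, ..., t_4 vanish, thanks to phi(x^2) = phi(x); if b_8, b_10, b_11, b_16 are all
nonzero there are exactly 8 solutions ([stabP]).  So the inertia group T of psi_b
has index q^4/8 in X_S, and T/M has order 8, generated by the images of
g_1 in X_1 X_4, g_2 in X_2 and g_3 in X_3.  A character eta of T over psi_b
satisfies eta(1)^2 <= 8, so eta(1) is 1 or 2, and it is 1 exactly when psi_b is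
trivial on [g_1,g_2], [g_2,g_3] and [g_3,g_1].  By Clifford's theorem the
characters of X_S over psi_b have degree q^4/8 or q^4/4 accordingly
([irr1_over_psi]).

The count.  The three commutators lie in X_5, X_6 X_9 and X_7, so the three signs
can be flipped independently by changing b_5, b_6 and b_7: one eighth of the
(q-1)^4 q^4 characters psi_b gives the low degree ([card_untwisted]).  Counting
pairs (chi, psi_b) weighted by degree, the squares of the degrees of the chi
lying over a given set of N characters psi_b, closed under conjugation, add up
to q^4 N ([sum_irr1_psi]).  This gives 8(q-1)^4 characters of degree q^4/8 and
14(q-1)^4 of degree q^4/4, and the latter are cut into seven equal families. *)

(** * Symbolic computation with root elements *)

(** Column c of the matrix of x_a(t), in sparse form: a pair (k, r) stands for
the monomial t^k in row r.  Only the parity of a coefficient matters. *)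
Definition column (a : rootF4) (c : nat) : seq (nat * nat) :=
  [seq kr <- [seq (k, r) | k <- iota 0 3, r <- iota 0 52] |
     odd `|adpow a kr.1 (nth (inr 0%N) chevbasis c)
                        (nth (inr 0%N) chevbasis kr.2)|].

(** Stored in evaluated form, because the checks below read these columns many
thousand times. *)
Definition root_columns : seq (seq (seq (nat * nat))) :=
  Eval vm_compute in
    [seq [seq column (alpha i) c | c <- iota 0 52] | i <- iota 1 24].

Lemma root_columnsE :
  root_columns = [seq [seq column (alpha i) c | c <- iota 0 52] | i <- iota 1 24].
Proof. by vm_compute. Qed.

(** A triple (j, p, r) stands for t^p s^r e_j when it belongs to a vector, and for
x_j(t^p s^r) when it belongs to a word; t and s are two indeterminates. *)
Definition monom := (nat * nat * nat)%type.

Definition root_column (i c : nat) := nth [::] (nth [::] root_columns i.-1) c.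

(** A vector is a formal sum in which a monomial may be repeated, so that applying
a root element needs no collection of terms. *)
Definition root_act (g : monom) (v : seq monom) : seq monom :=
  [seq (kr.2, (kr.1 * g.1.2 + x.1.2)%N, (kr.1 * g.2 + x.2)%N)
     | x <- v, kr <- root_column g.1.1 x.1.1].

(** The criterion for a formal sum to vanish in characteristic 2. *)
Definition cancels (v : seq monom) := all (fun x => ~~ odd (count_mem x v)) v.

Definition same_action (w1 w2 : seq monom) :=
  all (fun c => cancels (foldr root_act [:: (c, 0, 0)%N] w1
                      ++ foldr root_act [:: (c, 0, 0)%N] w2)) (iota 0 52).

(** The factors of the commutator of x_i(t) and x_j(s) in characteristic 2.  When
two short roots add up to a long one the structure constant is 2 or -2, so that
the factor disappears; all other structure constants that occur are odd. *)
Definition comm_roots (i j : nat) : seq monom :=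
  [seq x <- [seq (k, pr.1, pr.2) | k <- iota 1 24,
                                   pr <- [:: (1, 1); (1, 2); (2, 1)]%N] |
    (alpha x.1.1 == radd (rscale x.1.2%:Z (alpha i)) (rscale x.2%:Z (alpha j)))
    && ~~ [&& ip (alpha i) (alpha i) == 2, ip (alpha j) (alpha j) == 2
            & ip (alpha x.1.1) (alpha x.1.1) == 4]].

Definition posidx : seq nat := iota 1 24.

Lemma comm_roots_action :
  all (fun i => all (fun j =>
    same_action [:: (i, 1, 0); (j, 0, 1)]%N
              [:: (j, 0, 1)%N, (i, 1, 0)%N & comm_roots i j]) posidx) posidx.
Proof. by vm_compute. Qed.

(** Column c of x_i(t) x_i(s) = x_i(t + s).  As k <= 2, the monomial (t + s)^k is
t^k + s^k for k > 0, which is how the right hand side is entered. *)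
Definition additive_column (i c : nat) : bool :=
  cancels (foldr root_act [:: (c, 0, 0)%N] [:: (i, 1, 0); (i, 0, 1)]%N
        ++ flatten [seq if kr.1 == 0%N then [:: (kr.2, 0, 0)%N]
                        else [:: (kr.2, kr.1, 0); (kr.2, 0, kr.1)]%N
                      | kr <- root_column i c]).

Lemma additive_columns :
  all (fun i => all (additive_column i) (iota 0 52)) posidx.
Proof. by vm_compute. Qed.

(** Positions in the Chevalley basis of the positive root vectors and of the h_j.
They span the Borel subalgebra, which U stabilizes. *)
Definition borel (c : nat) := (c < 24)%N || (48 <= c)%N.

(** On the Borel subalgebra, x_j(t) leaves the coordinate along the root vector of
alpha_k unchanged. *)
Definition unit_row (k j : nat) :=
  all (fun c => ~~ borel c ||
         ([seq kr <- root_column j c | kr.2 == k.-1]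
            == if c == k.-1 then [:: (0%N, c)] else [::])) (iota 0 52).

Definition borel_stable (j : nat) :=
  all (fun c => ~~ borel c || all (fun kr => borel kr.2) (root_column j c))
      (iota 0 52).

(** Some h_j is sent by x_k(t) to a vector whose coordinate along the root vector
of alpha_k is t itself; there is one because the roots of F4 are not divisible
by 2 in the weight lattice. *)
Definition reads_parameter (k : nat) :=
  has (fun c => [seq kr <- root_column k c | kr.2 == k.-1] == [:: (1%N, k.-1)])
      (iota 48 4).

(** What makes the ordered product over l a group in which every factorization is
unique: each factor normalizes the product of those after it, and is told apart
from them by one matrix coordinate. *)
Fixpoint separated (l : seq nat) :=
  if l is k :: l' then
    [&& all (fun j => all (fun x => x.1.1 \in l') (comm_roots j k)) l',
        all (unit_row k) l', reads_parameter k & separated l']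
  else true.

(** The labels of S in an order that puts 1 and 4 first, so that the elements of the
inertia groups, in which x_1 and x_4 are coupled, have a convenient normal form,
and the abelian part last. *)
Definition labSord := [:: 1; 4; 2; 3; 5; 6; 7; 9; 8; 10; 11; 16]%N.

Lemma borel_stables : all borel_stable posidx. Proof. by vm_compute. Qed.
Lemma separatedK : separated labK. Proof. by vm_compute. Qed.
Lemma separatedSK : separated (labSord ++ labK). Proof. by vm_compute. Qed.
Lemma comm_rootsK :
  all (fun j => all (fun i => all (fun x => x.1.1 \in labK) (comm_roots i j)) labK)
      posidx.
Proof. by vm_compute. Qed.

(** * Ordered products of root subgroups *)

Lemma mem_comm_roots i j x : x \in comm_roots i j -> x.1.1 \in posidx.
Proof. by rewrite mem_filter => /andP[_ /allpairsP[[k pr] [? _ ->]]]. Qed.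

Section RootProducts.

Variables (F : finFieldType) (gT : finGroupType) (x : nat -> F -> gT).
Hypothesis char2 : 2%N \in [pchar F].
Hypothesis xD : forall i t s, i \in posidx -> x i (t + s) = (x i t * x i s)%g.
Hypothesis x_comm : forall i j t s, i \in posidx -> j \in posidx ->
  (x i t * x j s = x j s * x i t *
     \prod_(y <- comm_roots i j) x y.1.1 (t ^+ y.1.2 * s ^+ y.2)%R)%g.

Definition root_set (i : nat) : {set gT} := [set x i t | t : F].

Definition root_prod (l : seq nat) : {set gT} := (\prod_(i <- l) root_set i)%g.

Hypothesis x_separated : forall k l t, k \in posidx -> {subset l <= posidx} ->
  all (unit_row k) l -> reads_parameter k -> x k t \in root_prod l -> t = 0.

Lemma x_zero i : i \in posidx -> x i 0 = 1%g.
Proof.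
by move=> iP; apply: (mulgI (x i 0)); rewrite -xD // addr0 mulg1.
Qed.

Lemma root_set_group_set i : i \in posidx -> group_set (root_set i).
Proof.
move=> iP; apply/group_setP; split; first by apply/imsetP; exists 0; rewrite ?x_zero.
by move=> _ _ /imsetP[t _ ->] /imsetP[s _ ->]; rewrite -xD // imset_f.
Qed.

Lemma root_prod_sub l (P : {group gT}) :
  {in l, forall i, root_set i \subset P} -> root_prod l \subset P.
Proof.
move=> lP; rewrite /root_prod big_seq; elim/big_ind: _ => //.
- exact: sub1G.
- by move=> A B; apply: mul_subG.
Qed.

Lemma root_set_sub_prod l i : {subset l <= posidx} -> i \in l ->
  root_set i \subset root_prod l.
Proof.
rewrite /root_prod; elim: l => // j l IH jlP; rewrite in_cons big_cons.
have jP: j \in posidx by apply: jlP; rewrite mem_head.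
have lP: {subset l <= posidx} by move=> k kl; apply: jlP; rewrite in_cons kl orbT.
have one k : k \in posidx -> 1%g \in root_set k.
  by move/root_set_group_set=> gsk; apply: (group1 (Group gsk)).
case/predU1P=> [->|/(IH lP) sil]; last first.
  by apply: subset_trans sil (mulg_subr _ _); apply: one.
apply: mulg_subl; elim: (l) lP => [|k m IHm] kmP; first by rewrite big_nil inE.
rewrite big_cons -[1%g]mulg1 mem_mulg ?one ?kmP ?mem_head //.
by apply: IHm => y ym; apply: kmP; rewrite in_cons ym orbT.
Qed.

(** Conjugating x_j by x_k multiplies it by factors that the hypothesis puts back
into the product. *)
Lemma root_set_norm l k : {subset l <= posidx} -> k \in posidx ->
    group_set (root_prod l) ->
    all (fun j => all (fun y => y.1.1 \in l) (comm_roots j k)) l ->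
  root_set k \subset 'N(root_prod l)%g.
Proof.
move=> lP kP gsl /allP ckl.
apply/subsetP=> _ /imsetP[t _ ->]; rewrite inE.
rewrite {1}/root_prod (big_morph _ (fun A B => conjsMg A B _) (conjs1g _)).
rewrite -[root_prod l]/(gval (Group gsl)) big_seq.
elim/big_ind: _ => [|A B|j jl]; [exact: sub1G | exact: mul_subG |].
apply/subsetP=> _ /imsetP[_ /imsetP[s _ ->] ->].
have memP i u : i \in l -> x i u \in Group gsl.
  by move=> il; apply: (subsetP (root_set_sub_prod lP il)); rewrite imset_f.
(* x_j^(x_k) = x_j times the factors of their commutator *)
rewrite conjgE (x_comm _ _ (lP j jl) kP) !mulgA mulVg mul1g groupM ?memP //.
by rewrite big_seq group_prod // => y yc; apply/memP/(allP (ckl j jl)).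
Qed.

Lemma x_inj k : k \in posidx -> reads_parameter k -> injective (x k).
Proof.
move=> kP rk t s /eqP; rewrite -(inj_eq (mulIg (x k s)))-!xD // addrr_pchar2 //.
rewrite x_zero // => /eqP xts; apply/eqP; rewrite -subr_eq0 oppr_pchar2 //.
apply/eqP/(x_separated (l := [::]) kP) => //.
by rewrite xts /root_prod big_nil inE.
Qed.

(** By induction on l: the product of the tail is a group P normalized by the first
root subgroup X, and X meets P trivially by the separation hypothesis. *)
Lemma separated_group l : {subset l <= posidx} -> separated l ->
  group_set (root_prod l) /\ #|root_prod l| = (#|F| ^ size l)%N.
Proof.
elim: l => [|k l IH] klP /=.
  by move=> _; rewrite /root_prod big_nil cards1; split; first exact: group_set_one.
case/and4P=> ckl ukl rk sl.
have kP: k \in posidx by apply: klP; rewrite mem_head.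
have lP: {subset l <= posidx} by move=> j jl; apply: klP; rewrite in_cons jl orbT.
have [gsl cardl] := IH lP sl; have gsk := root_set_group_set kP.
pose P := Group gsl; pose X := Group gsk.
have nXP: X \subset 'N(P)%g by apply: root_set_norm.
have -> : root_prod (k :: l) = (X * P)%g by rewrite /root_prod big_cons.
split; first exact/comm_group_setP/normC.
have tiXP: (X :&: P = 1)%g.
  apply/trivgP/subsetP=> _ /setIP[/imsetP[t _ ->]].
  by move/(x_separated kP lP ukl rk)->; rewrite x_zero // group1.
by rewrite (TI_cardMg tiXP) /= cardl expnS (card_imset _ (x_inj kP rk)).
Qed.

Lemma labK_pos : {subset labK <= posidx}.
Proof. by move=> i; rewrite mem_filter => /andP[]. Qed.

Lemma labSK_pos : {subset labSord ++ labK <= posidx}.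
Proof. by apply/allP; vm_compute. Qed.

Lemma root_prodK_group_set : group_set (root_prod labK).
Proof. by case: (separated_group labK_pos separatedK). Qed.

Definition groupK := Group root_prodK_group_set.

Lemma root_prodSK_group_set : group_set (root_prod (labSord ++ labK)).
Proof. by case: (separated_group labSK_pos separatedSK). Qed.

Definition groupSK := Group root_prodSK_group_set.

Lemma groupSK_norm : groupSK \subset 'N(groupK)%g.
Proof.
apply: (root_prod_sub (P := normaliser_group _)) => i /labSK_pos iP.
apply: root_set_norm => //; [exact: labK_pos | exact: root_prodK_group_set |].
exact: (allP comm_rootsK).
Qed.

(** The image of a root element in the quotient by X_K. *)
Definition qx (i : nat) (t : F) : coset_of (root_prod labK) :=
  coset (root_prod labK) (x i t).

Lemma x_norm i t : i \in posidx -> x i t \in 'N(groupK)%g.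
Proof.
move=> iP; apply: (subsetP groupSK_norm).
apply: (subsetP (root_set_sub_prod labSK_pos _)); last exact: imset_f.
by move: i iP; apply/allP; vm_compute.
Qed.

Lemma qxK i t : i \in labK -> qx i t = 1%g.
Proof.
move=> iK; apply: (@coset_id _ groupK).
by apply: (subsetP (root_set_sub_prod labK_pos iK)); apply: imset_f.
Qed.

Lemma qxD i t s : i \in posidx -> qx i (t + s) = (qx i t * qx i s)%g.
Proof.
by move=> iP; rewrite /qx xD //; apply: (@morphM _ _ _ (coset_morphism groupK));
   apply: x_norm.
Qed.

Definition comm_rootsS i j := [seq y <- comm_roots i j | y.1.1 \in labSord].

(** The commutator relations survive in the quotient, without their factors in
X_K. *)
Lemma qx_comm i j t s : i \in posidx -> j \in posidx ->
  (qx i t * qx j s = qx j s * qx i t *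
     \prod_(y <- comm_rootsS i j) qx y.1.1 (t ^+ y.1.2 * s ^+ y.2)%R)%g.
Proof.
move=> iP jP.
have qM: {in 'N(groupK)%g &, {morph coset groupK : a b / (a * b)%g}}.
  exact: (@morphM _ _ _ (coset_morphism groupK)).
have prodE w : all (fun y => y.1.1 \in posidx) w ->
    coset groupK (\prod_(y <- w) x y.1.1 (t ^+ y.1.2 * s ^+ y.2)%R)%g
      = (\prod_(y <- w | y.1.1 \in labSord) qx y.1.1 (t ^+ y.1.2 * s ^+ y.2)%R)%g.
  elim: w => [|y w IH] /=; first by rewrite !big_nil morph1.
  case/andP=> yP wP; rewrite !big_cons qM ?IH ?x_norm //; last first.
    rewrite big_seq group_prod // => z zw; apply: x_norm; exact: (allP wP).
  case: ifP => // /negbT ySord; rewrite [coset _ _]qxK ?mul1g //.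
  have: (y.1.1 \in labSord) || (y.1.1 \in labK).
    by move: (y.1.1) yP; apply/allP; vm_compute.
  by case/orP=> [yS|yK]; [rewrite yS in ySord | exact: yK].
have chP: all (fun y => y.1.1 \in posidx) (comm_roots i j).
  by apply/allP=> y; apply: mem_comm_roots.
rewrite /qx -[LHS]qM ?x_norm // x_comm // !qM ?groupM ?x_norm //; last first.
  by rewrite big_seq group_prod // => y /(allP chP); apply: x_norm.
by rewrite prodE // big_filter.
Qed.

Lemma quotient_prod :
  (groupSK / groupK)%g = (\prod_(i <- labSord) [set qx i t | t : F])%g :> {set _}.
Proof.
have normP l : {subset l <= posidx} -> root_prod l \subset 'N(groupK)%g.
  move=> lP; apply: root_prod_sub => i /lP iP.
  by apply/subsetP=> _ /imsetP[t _ ->]; apply: x_norm.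
have SP: {subset labSord <= posidx} by apply/allP; vm_compute.
transitivity ((root_prod labSord * root_prod labK) / groupK)%g.
  by rewrite /root_prod -big_cat.
rewrite quotientMr; last exact/normP/labK_pos.
rewrite [X in (_ * X)%g](quotientS1 (H := groupK) (G := groupK)) // mulg1 /root_prod.
elim: labSord SP => [|i l IH] ilP; first by rewrite !big_nil quotient1.
have iP : i \in posidx by apply: ilP; rewrite mem_head.
have lP: {subset l <= posidx} by move=> j jl; apply: ilP; rewrite in_cons jl orbT.
rewrite !big_cons quotientMr ?IH //; last exact: normP.
congr (_ * _)%g; rewrite /quotient morphimEsub; last first.
  by apply/subsetP=> _ /imsetP[t _ ->]; apply: x_norm.
by rewrite -imset_comp.
Qed.

Lemma card_quotient_prod : #|(groupSK / groupK)%g| = (#|F| ^ 12)%N.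
Proof.
have [_ cardSK] := separated_group labSK_pos separatedSK.
have [_ cardK] := separated_group labK_pos separatedK.
have sKSK: groupK \subset groupSK.
  by apply: root_prod_sub => i iK; apply: root_set_sub_prod;
     [exact: labSK_pos | rewrite mem_cat iK orbT].
rewrite card_quotient ?groupSK_norm // -divgS //= cardSK cardK.
rewrite (_ : size labK = 12) // (_ : size (labSord ++ labK) = (12 + 12)%N) //.
by rewrite expnD mulnK // expn_gt0 (ltnW (finNzRing_gt1 _)).
Qed.

End RootProducts.

(** * The root elements as matrices *)

Section RootElements.
Variable F : finFieldType.
Hypothesis char2 : 2%N \in [pchar F].

Definition bvec (r : nat) : 'cV[F]_52 := delta_mx (inord r) 0.

Definition eval_vec (t s : F) (v : seq monom) : 'cV[F]_52 :=
  \sum_(x <- v) (t ^+ x.1.2 * s ^+ x.2) *: bvec x.1.1.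

(** Signs and even coefficients are invisible in F. *)
Lemma intr_odd (z : int) : z%:~R = (odd `|z|)%:R :> F.
Proof.
have natr_odd n : n%:R = (odd n)%:R :> F.
  rewrite -{1}(odd_double_half n) natrD -mul2n natrM.
  by rewrite (pcharf0 char2) mul0r addr0.
case: z => n; first by rewrite -natr_odd.
by rewrite NegzE mulrNz oppr_pchar2 // abszN -natr_odd.
Qed.

Lemma xmat_bvec a u c : (c < 52)%N ->
  xmat a u *m bvec c = \sum_(kr <- column a c) u ^+ kr.1 *: bvec kr.2.
Proof.
move=> ltc; apply/colP=> r; rewrite -colE !mxE summxE /column.
rewrite big_filter [RHS]big_mkcond big_allpairs_dep -/(index_iota 0 3) big_mkord.
apply: eq_bigr => k _; rewrite inordK // -/(index_iota 0 52) big_mkord.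
rewrite (bigD1 r) //= [X in _ + X]big1 => [|i ne_ir]; last first.
  by rewrite !mxE inord_val andbT eq_sym (negbTE ne_ir) mulr0 if_same.
rewrite addr0 !mxE inord_val eqxx mulr1 intr_odd.
by case: (odd _); rewrite ?mul1r ?mul0r.
Qed.

Lemma mem_column a c kr : kr \in column a c -> (kr.1 < 3)%N && (kr.2 < 52)%N.
Proof.
rewrite mem_filter => /andP[_ /allpairsP[[k r] [k3 r52 ->]]].
by move: k3 r52; rewrite !mem_iota !add0n => /andP[_ k3] /andP[_ r52]; apply/andP.
Qed.

Lemma nth_table T (g : nat -> nat -> seq T) m n i c : (i < m)%N -> (c < n)%N ->
  nth [::] (nth [::] [seq [seq g j k | k <- iota 0 n] | j <- iota 1 m] i) c
    = g i.+1 c.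
Proof.
move=> ltim ltcn; rewrite (nth_map 0%N) ?size_iota // (nth_map 0%N) ?size_iota //.
by rewrite !nth_iota.
Qed.

Lemma root_columnE i c : i \in posidx -> (c < 52)%N ->
  root_column i c = column (alpha i) c.
Proof.
rewrite mem_iota => /andP[i_gt0 lti25] ltc52; rewrite /root_column root_columnsE.
case: i i_gt0 lti25 => [//|i] _ lti24.
exact: (@nth_table _ (fun i c => column (alpha i) c)).
Qed.

(** The columns are tabulated only for the 52 positions of the basis. *)
Definition bounded (v : seq monom) := all (fun x => (x.1.1 < 52)%N) v.

Lemma root_act_bounded g v : g.1.1 \in posidx -> bounded v -> bounded (root_act g v).
Proof.
move=> gP /allP bv; apply/allP=> _ /allpairsPdep[x [kr [xv kr_col ->]]] /=.
by move: kr_col; rewrite root_columnE ?bv // => /mem_column /andP[].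
Qed.

(** [root_act] computes the matrix action, for all values of t and s at once. *)
Lemma xmat_act t s (g : monom) v : g.1.1 \in posidx -> bounded v ->
  xmat (alpha g.1.1) (t ^+ g.1.2 * s ^+ g.2) *m eval_vec t s v
    = eval_vec t s (root_act g v).
Proof.
move=> gP /allP bv; rewrite /eval_vec mulmx_sumr /root_act big_allpairs_dep.
apply: eq_big_seq => x /bv xv.
rewrite -scalemxAr xmat_bvec // -root_columnE // scaler_sumr.
apply: eq_bigr => kr _; rewrite scalerA /=; congr (_ *: _).
by rewrite exprMn !exprD ![(kr.1 * _)%N]mulnC !exprM mulrC mulrACA.
Qed.

Lemma eval_cancels t s v : cancels v -> eval_vec t s v = 0.
Proof.
move/allP=> ev; rewrite /eval_vec -big_undup_iterop_count big1_seq //= => x.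
rewrite mem_undup => /ev/negPf evx; rewrite -[iterop _ _ _ _]/(_ *+ _).
set w := _ *: _; rewrite -(odd_double_half (count_mem x v)) evx add0n -mul2n.
by rewrite mulrnA -[w *+ 2]scaler_nat (pcharf0 char2) scale0r mul0rn.
Qed.

Lemma eval_cat t s v1 v2 :
  cancels (v1 ++ v2) -> eval_vec t s v1 = eval_vec t s v2.
Proof.
move/(eval_cancels t s); rewrite /eval_vec big_cat /=.
move/eqP; rewrite addr_eq0 => /eqP ->; rewrite -scaleN1r.
by rewrite oppr_pchar2 // scale1r.
Qed.

Definition eval_word t s (w : seq monom) : 'M[F]_52 :=
  foldr (fun g A => xmat (alpha g.1.1) (t ^+ g.1.2 * s ^+ g.2) *m A) 1%:M w.

Lemma eval_wordP t s w v : all (fun g => g.1.1 \in posidx) w -> bounded v ->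
  bounded (foldr root_act v w) /\
  eval_word t s w *m eval_vec t s v = eval_vec t s (foldr root_act v w).
Proof.
move=> + bv; elim: w => [|g w IH] /=; first by rewrite mul1mx.
case/andP=> gP /IH[bw IHw]; split; first exact: root_act_bounded.
by rewrite -mulmxA IHw xmat_act.
Qed.

Lemma eval_basis t s c : eval_vec t s [:: (c, 0, 0)%N] = bvec c.
Proof. by rewrite /eval_vec big_seq1 mulr1 scale1r. Qed.

Lemma eq_mx_bvec (A B : 'M[F]_52) :
  (forall c, (c < 52)%N -> A *m bvec c = B *m bvec c) -> A = B.
Proof.
move=> eqAB; apply/matrixP=> r c; have := eqAB _ (ltn_ord c).
by rewrite /bvec inord_val -!colE => /colP/(_ r); rewrite !mxE.
Qed.

(** Two words with the same symbolic action on the 52 basis vectors are equal as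
matrices. *)
Lemma eval_same_action t s w1 w2 :
    all (fun g => g.1.1 \in posidx) w1 -> all (fun g => g.1.1 \in posidx) w2 ->
  same_action w1 w2 -> eval_word t s w1 = eval_word t s w2.
Proof.
move=> w1P w2P /allP sw; apply: eq_mx_bvec => c c52.
have bc: bounded [:: (c, 0, 0)%N] by rewrite /bounded /= c52.
rewrite -(eval_basis t s c) (eval_wordP t s w1P bc).2 (eval_wordP t s w2P bc).2.
by apply/eval_cat/sw; rewrite mem_iota.
Qed.

Lemma xmatD i (t s : F) : i \in posidx ->
  xmat (alpha i) t *m xmat (alpha i) s = xmat (alpha i) (t + s).
Proof.
move=> iP; apply: eq_mx_bvec => c c52.
have bc: bounded [:: (c, 0, 0)%N] by rewrite /bounded /= c52.
have wP: all (fun g => g.1.1 \in posidx) [:: (i, 1, 0); (i, 0, 1)]%N.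
  by rewrite /= iP.
have := allP (allP additive_columns i iP) c; rewrite mem_iota c52.
move=> /(_ isT)/(eval_cat t s); rewrite -(eval_wordP t s wP bc).2 eval_basis /=.
rewrite mulmx1 !expr1 !expr0 mulr1 mul1r => ->.
rewrite xmat_bvec // /eval_vec big_flatten big_map /= root_columnE //.
apply: eq_big_seq => -[k r] /mem_column /andP[/= k3 _].
case: k k3 => [|k] k3 /=; first by rewrite big_seq1 !expr0 mulr1.
rewrite big_cons big_seq1 /= expr0 mulr1 mul1r -scalerDl; congr (_ *: _).
case: k k3 => [|[|//]] _; rewrite ?expr1 //.
by rewrite sqrrD -mulr_natr (pcharf0 char2) mulr0 addr0.
Qed.

Lemma xmat0 a : xmat a (0 : F) = 1%:M.
Proof.
apply/matrixP=> i j; rewrite !mxE big_ord_recl big1 => [|k _]; last first.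
  by rewrite expr0n mulr0.
rewrite addr0 expr0 mulr1 /adpow /= nth_uniq //.
case: eqP => [/val_inj->|ne_ij]; rewrite ?eqxx //.
by case: eqP => // eq_ij; case: ne_ij; rewrite eq_ij.
Qed.

Lemma xmat_entry i (u : F) (r c : 'I_52) : i \in posidx ->
  xmat (alpha i) u r c =
    \sum_(kr <- [seq kr <- root_column i c | kr.2 == r :> nat]) u ^+ kr.1.
Proof.
move=> iP; have := xmat_bvec (alpha i) u (ltn_ord c).
rewrite /bvec inord_val -colE => /colP/(_ r); rewrite mxE => ->.
rewrite -root_columnE // summxE big_filter [RHS]big_mkcond /=.
apply: eq_big_seq => kr; rewrite root_columnE // => /mem_column/andP[_ lt52].
rewrite !mxE eqxx andbT -(inj_eq val_inj) /= inordK // eq_sym.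
by case: eqP; rewrite ?mulr1 ?mulr0.
Qed.

(** Stability of the Borel subalgebra. *)
Definition borel_mx (A : 'M[F]_52) :=
  forall r c : 'I_52, borel c -> ~~ borel r -> A r c = 0.

(** The coordinate functional along the root vector of alpha_k, restricted to the
Borel subalgebra, is fixed. *)
Definition unit_row_mx (k : nat) (A : 'M[F]_52) :=
  forall r c : 'I_52, r = k.-1 :> nat -> borel c -> A r c = (c == r)%:R.

Lemma borel_mxM A B : borel_mx A -> borel_mx B -> borel_mx (A *m B).
Proof.
move=> bA bB r c bc br; rewrite mxE big1 // => d _.
by case: (boolP (borel d)) => bd; [rewrite bA ?mul0r | rewrite [B _ _]bB ?mulr0].
Qed.

(** A functional fixed on a stable subspace by two maps is fixed by their product. *)
Lemma unit_row_mxM k A B : unit_row_mx k A -> borel_mx B -> unit_row_mx k B ->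
  unit_row_mx k (A *m B).
Proof.
move=> uA bB uB r c rk bc; rewrite mxE -(uB r c rk bc) (bigD1 r) //=.
rewrite big1 => [|d ne_dr].
  case: (boolP (borel r)) => br; first by rewrite addr0 (uA r r) // eqxx mul1r.
  by rewrite addr0 [B _ _]bB // mulr0.
case: (boolP (borel d)) => bd; last by rewrite [B _ _]bB ?mulr0.
by rewrite (uA r d) // (negbTE ne_dr) mul0r.
Qed.

Lemma xmat_borel i u : i \in posidx -> borel_mx (xmat (alpha i) u).
Proof.
move=> iP r c bc br; rewrite xmat_entry //.
have := allP (allP borel_stables i iP) c; rewrite mem_iota ltn_ord bc => /(_ isT).
move=> /allP bcol; rewrite big_filter big1_seq // => kr /andP[/eqP eq_r /bcol].
by rewrite eq_r (negbTE br).
Qed.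

Lemma xmat_unit_row k i u : i \in posidx -> unit_row k i ->
  unit_row_mx k (xmat (alpha i) u).
Proof.
move=> iP uk r c rk bc; rewrite xmat_entry // rk.
have := allP uk c; rewrite mem_iota ltn_ord bc => /(_ isT)/eqP ->.
rewrite -rk (inj_eq val_inj).
by case: eqP => _; rewrite ?big_nil // big_seq1 expr0.
Qed.

Lemma xmat_reads_parameter k : k \in posidx -> reads_parameter k ->
  exists2 rc : 'I_52 * 'I_52, [&& rc.1 == k.-1 :> nat, borel rc.2 & rc.2 != rc.1]
     & forall u : F, xmat (alpha k) u rc.1 rc.2 = u.
Proof.
move=> kP /hasP[c]; have := kP; rewrite !mem_iota => /andP[k0 k25].
case/andP=> c48 c52 /eqP colk; have k52: (k.-1 < 52)%N.
  by rewrite (leq_trans _ (isT : 24 <= 52)%N) // -ltnS prednK.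
exists (Ordinal k52, Ordinal c52).
  rewrite /= eqxx /borel /= c48 orbT -(inj_eq val_inj) /= neq_ltn.
  by rewrite [(k.-1 < c)%N](leq_trans _ c48) ?orbT // prednK // (leq_trans (ltnW k25)).
by move=> u; rewrite xmat_entry // colk big_seq1 expr1.
Qed.

Lemma GLval_inj : injective (@GLval 52 F). Proof. exact: val_inj. Qed.

Lemma GLvalM (g h : {'GL_52[F]}) : GLval (g * h)%g = GLval g *m GLval h.
Proof. by []. Qed.

Lemma GLval1 : GLval (1%g : {'GL_52[F]}) = 1%:M.
Proof. by []. Qed.

(** For a positive root the default value 1 is not reached: the matrix of x_i(t)
squares to 1, so it is invertible. *)
Definition xg (i : nat) (t : F) : {'GL_52[F]} :=
  insubd (1%g : {'GL_52[F]}) (xmat (alpha i) t).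

Lemma GLval_xg i t : i \in posidx -> GLval (xg i t) = xmat (alpha i) t.
Proof.
move=> iP; apply: (@insubdK _ _ {'GL_52[F]}).
have xx: xmat (alpha i) t *m xmat (alpha i) t = 1%:M.
  by rewrite xmatD // addrr_pchar2 // xmat0.
by case: (mulmx1_unit xx).
Qed.

Lemma xgD i t s : i \in posidx -> xg i (t + s) = (xg i t * xg i s)%g.
Proof.
by move=> iP; apply: GLval_inj; rewrite GLvalM !GLval_xg // xmatD.
Qed.

Lemma GLval_word t s (w : seq monom) : all (fun g => g.1.1 \in posidx) w ->
  GLval (\prod_(g <- w) xg g.1.1 (t ^+ g.1.2 * s ^+ g.2)%R)%g = eval_word t s w.
Proof.
elim: w => [|g w IH] /=; first by rewrite big_nil.
by case/andP=> gP /IH IHw; rewrite big_cons GLvalM GLval_xg // -IHw.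
Qed.

Lemma xg_comm i j t s : i \in posidx -> j \in posidx ->
  (xg i t * xg j s = xg j s * xg i t *
     \prod_(x <- comm_roots i j) xg x.1.1 (t ^+ x.1.2 * s ^+ x.2)%R)%g.
Proof.
move=> iP jP; have := allP (allP comm_roots_action i iP) j jP.
have chP: all (fun g => g.1.1 \in posidx) (comm_roots i j).
  by apply/allP=> x; apply: mem_comm_roots.
move/(@eval_same_action t s); rewrite -!GLval_word /= ?iP ?jP //.
move/(_ isT chP)/GLval_inj; rewrite !big_cons big_nil /=.
by rewrite !expr1 !expr0 !mulr1 !mul1r mulg1 mulgA.
Qed.

Lemma rootsubgE i : i \in posidx -> rootsubg F (alpha i) = root_set xg i.
Proof.
move=> iP; apply/setP=> g; rewrite inE; apply/existsP/imsetP=> [[t /eqP gt]|[t _ ->]].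
  by exists t => //; apply: GLval_inj; rewrite GLval_xg.
by exists t; rewrite GLval_xg.
Qed.

(** Every factor of the product fixes a coordinate of the Borel subalgebra in which
x_k(t) shows the value t. *)
Lemma xg_separated k l t : k \in posidx -> {subset l <= posidx} ->
  all (unit_row k) l -> reads_parameter k -> xg k t \in root_prod xg l -> t = 0.
Proof.
move=> kP lP ukl rk.
have [[r c] /= /and3P[/eqP rk1 bc ne_cr] readX] := xmat_reads_parameter kP rk.
suff P_sep g : g \in root_prod xg l ->
    borel_mx (GLval g) /\ unit_row_mx k (GLval g).
  move/P_sep=> [_ /(_ r c rk1 bc)].
  by rewrite (negbTE ne_cr) GLval_xg // readX.
elim: l lP ukl g => [|j m IH] jmP /=.
  move=> _ g; rewrite /root_prod big_nil => /set1P->; rewrite GLval1.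
  split=> r' c'; rewrite !mxE; last by move=> _ _; rewrite eq_sym.
  by move=> bc' br'; case: eqP => // eq_rc; rewrite eq_rc bc' in br'.
have jP: j \in posidx by apply: jmP; rewrite mem_head.
case/andP=> uj um g; rewrite /root_prod big_cons.
case/mulsgP=> _ h /imsetP[s _ ->] mh ->.
have mP: {subset m <= posidx} by move=> i im; apply: jmP; rewrite in_cons im orbT.
have [bh uh] := IH mP um h mh.
rewrite GLvalM GLval_xg //; split; first exact/borel_mxM/bh/xmat_borel.
by apply: unit_row_mxM => //; apply: xmat_unit_row.
Qed.

Lemma root_prodE l : {subset l <= posidx} ->
  (\prod_(i <- l) rootsubg F (alpha i))%g = root_prod xg l.
Proof.
by move=> lP; rewrite /root_prod; apply: eq_big_seq => i /lP /rootsubgE.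
Qed.

Lemma XKE : XK F = root_prod xg labK.
Proof. exact/root_prodE/labK_pos. Qed.

Definition GSK := groupSK char2 xgD xg_comm xg_separated.

Lemma UF4E : UF4 F = GSK :> {set _}.
Proof.
have posE: posrootsF4 = [seq alpha i | i <- posidx] by [].
rewrite /UF4 posE big_map; apply/eqP; rewrite eqEsubset gen_subG; apply/andP; split.
  rewrite big_seq; elim/big_ind: _ => [|A B sA sB|i iP]; first exact: sub0set.
    by rewrite subUset sA.
  rewrite rootsubgE //; apply: (root_set_sub_prod xgD labSK_pos).
  by move: i iP; apply/allP; vm_compute.
apply: (root_prod_sub (P := generated_group _)) => i /labSK_pos iP.
by apply: sub_gen; rewrite (big_rem i) //= rootsubgE // subsetUl.
Qed.

(** All that the character theory uses of X_S: root elements that are additive and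
satisfy the commutator relations, normal forms, and the order, which makes the
normal forms unique. *)
Lemma XS_structure : exists y : nat -> F -> coset_of (XK F),
  [/\ forall i t s, i \in posidx -> y i (t + s) = (y i t * y i s)%g,
      forall i j t s, i \in posidx -> j \in posidx ->
        (y i t * y j s = y j s * y i t *
          \prod_(z <- comm_rootsS i j) y z.1.1 (t ^+ z.1.2 * s ^+ z.2)%R)%g,
      XS F = (\prod_(i <- labSord) [set y i t | t : F])%g :> {set _},
      #|XS F| = (#|F| ^ 12)%N
    & forall i, i \in posidx ->
        (rootsubg F (alpha i) / XK F)%g = [set y i t | t : F]].
Proof.
rewrite /XS /= UF4E XKE; exists (qx xg); split.
- by move=> i t s; apply: (qxD char2 xgD xg_comm xg_separated).
- by move=> i j t s; apply: (qx_comm char2 xgD xg_comm xg_separated).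
- exact: (quotient_prod char2 xgD xg_comm xg_separated).
- exact: (card_quotient_prod char2 xgD xg_comm xg_separated).
move=> i iP; rewrite rootsubgE // /quotient morphimEsub; last first.
  by apply/subsetP=> _ /imsetP[t _ ->]; apply: (x_norm char2 xgD xg_comm xg_separated).
by rewrite -imset_comp.
Qed.

End RootElements.

(** * Degrees over a linear character of a normal subgroup *)

Section Clifford.
Variable gT : finGroupType.

(** The sum over the conjugacy class in Clifford's theorem has a single term. *)
Lemma cfRes_invariant_lin (T M : {group gT}) (i : Iirr T) (j : Iirr M) :
    (M <| T)%g -> 'chi_j \is a linear_char -> T \subset 'I['chi_j]%g ->
    j \in irr_constt ('Res[M] 'chi_i) ->
  'Res[M] 'chi_i = 'chi_i 1%g *: 'chi_j.
Proof.
move=> nsMT lin_j inv_j /(Clifford_Res_sum_cfclass nsMT).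
rewrite cfclass_invariant // big_seq1; set c := '[_, _] => Res_i.
by rewrite -(cfRes1 M) Res_i cfunE lin_char1 // mulr1.
Qed.

(** On M, which contains the derived subgroup, chi_i is a multiple of chi_j, so that
the two kernels meet M in the same subgroup. *)
Lemma lin_over_invariant (T M : {group gT}) (i : Iirr T) (j : Iirr M) :
    (M <| T)%g -> 'chi_j \is a linear_char -> T \subset 'I['chi_j]%g ->
    j \in irr_constt ('Res[M] 'chi_i) -> T^`(1)%g \subset M ->
  ('chi_i \is a linear_char) = (T^`(1)%g \subset cfker 'chi_j).
Proof.
move=> nsMT lin_j inv_j Mj sT'M.
have Res_i := cfRes_invariant_lin nsMT lin_j inv_j Mj.
have kerE x : x \in M -> (x \in cfker 'chi_i) = (x \in cfker 'chi_j).
  move=> Mx; rewrite !cfkerEirr !inE (lin_char1 lin_j).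
  rewrite -(cfResE _ (normal_sub nsMT) Mx) Res_i cfunE -[X in _ == X]mulr1.
  exact/inj_eq/mulfI/irr1_neq0.
rewrite lin_irr_der1; apply/subsetP/subsetP=> sT' x T'x.
  by rewrite -kerE ?sT' ?(subsetP sT'M).
by rewrite kerE ?sT' ?(subsetP sT'M).
Qed.

(** M acts by scalars in the representation, so it lies in the center of chi_i. *)
Lemma irr1_over_invariant (T M : {group gT}) (i : Iirr T) (j : Iirr M) :
    (M <| T)%g -> 'chi_j \is a linear_char -> T \subset 'I['chi_j]%g ->
    j \in irr_constt ('Res[M] 'chi_i) ->
  'chi_i 1%g ^+ 2 <= #|T : M|%g%:R.
Proof.
move=> nsMT lin_j inv_j Mj; have [sMT _] := andP nsMT.
have Res_i := cfRes_invariant_lin nsMT lin_j inv_j Mj.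
apply: (le_trans (irr1_bound i)); rewrite ler_nat dvdn_leq ?indexg_gt0 //.
apply: indexgS; apply/subsetP=> x Mx.
rewrite irr_cfcenterE ?(subsetP sMT) // -(cfResE _ sMT Mx) Res_i cfunE.
by rewrite normrM (normC_lin_char lin_j Mx) mulr1 ger0_norm // ltW // irr1_gt0.
Qed.

(** chi_k is induced from a character of the inertia group, whose degree is at most
2 since its square is at most the index of M in that group. *)
Lemma irr1_Clifford (G M : {group gT}) (k : Iirr G) (j : Iirr M)
    (T := 'I_G['chi_j]%G) :
    (M <| G)%g -> 'chi_j \is a linear_char ->
    j \in irr_constt ('Res[M] 'chi_k) ->
    T^`(1)%g \subset M -> (#|T : M|%g <= 8)%N ->
  'chi_k 1%g = #|G : T|%g%:R * (if T^`(1)%g \subset cfker 'chi_j then 1 else 2).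
Proof.
move=> nsMG lin_j; rewrite -constt_Ind_Res => kj sT'M index_le8.
have [sMG _] := andP nsMG; have nsMT: (M <| T)%g := normal_Inertia _ sMG.
have sTG: T \subset G := subsetIl _ _.
have inv_j: T \subset 'I['chi_j]%g := subsetIr _ _.
have [irrInd _ imInd _ _] := constt_Inertia_bijection j nsMG.
have := kj; rewrite -imInd => /imsetP[i ij def_k].
have -> : 'chi_k = 'Ind[G] 'chi_i by rewrite def_k cfIirrE // irrInd.
rewrite cfInd1 //; congr (_ * _); move: ij; rewrite constt_Ind_Res => ij.
have lin_i := lin_over_invariant nsMT lin_j inv_j ij sT'M.
have bound_i := irr1_over_invariant nsMT lin_j inv_j ij.
case: ifP => [sT'K | /negbT nsT'K]; first by rewrite lin_char1 // lin_i.
have: 'chi_i 1%g != 1.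
  by apply: contra nsT'K => chi1; rewrite -lin_i qualifE /= irr_char.
have := irr1_gt0 i.
have := le_trans bound_i (_ : _ <= 8%:R); rewrite ler_nat => /(_ index_le8).
have /natrP[n ->] := Cnat_irr1 i.
rewrite -natrX ler_nat ltr0n pnatr_eq1.
(* the degree is positive, not 1, and its square is at most 8 *)
case: n => [|[|[|n]]] // sq_le8 _ _.
have: (3 ^ 2 <= n.+3 ^ 2)%N by rewrite leq_exp2r.
by move/leq_trans/(_ sq_le8).
Qed.

(** Both sides count pairs: Frobenius reciprocity evaluates the multiplicities
weighted by the product of the degrees, once from G and once from M. *)
Lemma sum_irr1_sq (G M : {group gT}) (A : {set Iirr G}) (B : {set Iirr M}) :
    M \subset G ->
    (forall k j, j \in irr_constt ('Res[M] 'chi_k) -> (k \in A) = (j \in B)) ->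
  \sum_(k in A) 'chi_k 1%g ^+ 2 = #|G : M|%g%:R * \sum_(j in B) 'chi_j 1%g ^+ 2.
Proof.
move=> sMG AB; pose c (k : Iirr G) (j : Iirr M) : algC := '['Res[M] 'chi_k, 'chi_j].
have cE k j : '['Ind[G] 'chi_j, 'chi_k] = c k j.
  rewrite /c cfdot_Res_l cfdotC conj_natr // Cnat_cfdot_char ?irr_char //.
  by rewrite cfInd_char ?irr_char.
have c0 k j : (k \in A) != (j \in B) -> c k j = 0.
  by apply: contraNeq => ckj; rewrite (AB k j) // irr_consttE.
transitivity (\sum_(k in A) \sum_(j in B) 'chi_k 1%g * c k j * 'chi_j 1%g).
  apply: eq_bigr => k kA; rewrite expr2 -{2}(cfRes1 M) ['Res 'chi_k]cfun_sum_cfdot.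
  rewrite sum_cfunE (bigID (mem B)) /= [X in _ + X]big1 ?addr0 => [|j jB].
    by rewrite mulr_sumr; apply: eq_bigr => j _; rewrite cfunE mulrA.
  by rewrite cfunE -/(c k j) c0 ?mul0r // kA (negbTE jB).
rewrite exchange_big mulr_sumr; apply: eq_bigr => j jB /=.
rewrite -mulr_suml expr2 mulrA -cfInd1 //; congr (_ * _).
rewrite ['Ind _]cfun_sum_cfdot sum_cfunE [RHS](bigID (mem A)) /=.
rewrite [X in _ + X]big1 ?addr0 => [|k kA].
  by apply: eq_bigr => k _; rewrite cfunE mulrC cE.
by rewrite cfunE cE c0 ?mul0r // jB (negbTE kA).
Qed.

(** The conjugates of chi_j all agree at a central element. *)
Lemma irr_central (G M : {group gT}) (k : Iirr G) (j : Iirr M) z :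
    (M <| G)%g -> 'chi_j \is a linear_char -> j \in irr_constt ('Res[M] 'chi_k) ->
    z \in M -> z \in 'C(G)%g ->
  'chi_k z = 'chi_k 1%g * 'chi_j z.
Proof.
move=> nsMG lin_j Mj Mz cGz; have [sMG nMG] := andP nsMG.
have Res_k := Clifford_Res_sum_cfclass nsMG Mj.
rewrite -(cfRes1 M) -(cfResE _ sMG Mz) Res_k !cfunE -mulrA !sum_cfunE mulr_suml.
congr (_ * _); apply: eq_big_seq => xi /cfclassP[g Gg ->].
rewrite cfConjg1 lin_char1 // mul1r cfConjgE ?(subsetP nMG) //.
by rewrite conjgE invgK mulgA -(centP cGz g Gg) mulgK.
Qed.

End Clifford.

(** * The trace character and the dual of an elementary abelian group *)

Section Trace.
Variables (F : finFieldType) (f : nat).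
Hypotheses (f_gt0 : (0 < f)%N) (cardF : #|F| = (2 ^ f)%N).

Lemma char2F : 2%N \in [pchar F].
Proof. exact: card_finPcharP cardF _. Qed.

(** The trace of F over its prime field. *)
Definition trace2 (x : F) : F := \sum_(i < f) x ^+ (2 ^ i).

Lemma trace2D x y : trace2 (x + y) = trace2 x + trace2 y.
Proof.
rewrite -big_split; apply: eq_bigr => i _; rewrite /= exprDn_pchar //.
by rewrite pnatX pnatE // char2F.
Qed.

Lemma trace2_sqr x : trace2 (x ^+ 2) = trace2 x.
Proof.
rewrite /trace2 -(prednK f_gt0) big_ord_recr [RHS]big_ord_recl /= addrC.
congr (_ + _); first by rewrite -exprM -expnS prednK // -cardF expf_card expn0.
by apply: eq_bigr => i _; rewrite -exprM -expnS.
Qed.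

Lemma trace2_eq01 x : (trace2 x == 0) || (trace2 x == 1).
Proof.
have sqrD: {morph (fun y : F => y ^+ 2) : y z / y + z}.
  by move=> y z; rewrite exprDn_pchar // pnatE // char2F.
have: trace2 x ^+ 2 = trace2 x.
  rewrite -[RHS]trace2_sqr /trace2 (big_morph _ sqrD (expr0n _ 2)).
  by apply: eq_bigr => i _; rewrite exprAC.
by move/eqP; rewrite -subr_eq0 expr2 -{3}[trace2 x]mulr1 -mulrBr mulf_eq0 subr_eq0.
Qed.

(** The trace is a nonzero polynomial of degree q/2, so it cannot vanish on all of
F. *)
Lemma trace2_neq0 : exists x, trace2 x != 0.
Proof.
pose p : {poly F} := \sum_(i < f) 'X^(2 ^ i).
have size_p : (size p <= (2 ^ f.-1).+1)%N.
  apply: (leq_trans (size_sum _ _ _)); apply/bigmax_leqP => i _.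
  by rewrite size_polyXn ltnS leq_exp2l // -ltnS prednK.
have p_neq0: p != 0.
  apply/eqP=> /(congr1 (fun r : {poly F} => r`_1)); rewrite coef0 coef_sum.
  rewrite -(prednK f_gt0) big_ord_recl big1 => [|i _].
    by rewrite coefXn addr0; apply/eqP; rewrite oner_eq0.
  by rewrite coefXn /= -[1%N](expn0 2) eqn_exp2l.
apply/existsP; rewrite -[[exists x, _]]negbK negb_exists.
apply/negP=> /forallP trace0; have roots: all (root p) (enum F).
  apply/allP=> x _; have := trace0 x; rewrite negbK => /eqP tr0.
  apply/rootP; rewrite /p horner_sum -[RHS]tr0; apply: eq_bigr => i _.
  by rewrite hornerXn.
have := leq_trans (max_poly_roots p_neq0 roots (enum_uniq F)) size_p.
by rewrite -cardE cardF ltnS leq_exp2l // leqNgt prednK ?leqnn.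
Qed.

Definition phi (x : F) : algC := if trace2 x == 0 then 1 else -1.

Lemma phiD x y : phi (x + y) = phi x * phi y.
Proof.
rewrite /phi trace2D.
case/orP: (trace2_eq01 x) => /eqP->; case/orP: (trace2_eq01 y) => /eqP->;
  rewrite ?addr0 ?add0r ?eqxx ?(negbTE (oner_neq0 _)) ?mul1r ?mulr1 //.
by rewrite (addrr_pchar2 char2F) eqxx mulrNN mulr1.
Qed.

(** Conjugate elements have the same trace.  This is what turns conditions that mix
t and t^2 into polynomial equations. *)
Lemma phi_sqr x : phi (x ^+ 2) = phi x.
Proof. by rewrite /phi trace2_sqr. Qed.

Lemma phi_pm1 x : phi x = 1 \/ phi x = -1.
Proof. by rewrite /phi; case: ifP; [left | right]. Qed.

Lemma phi_nontrivial : exists x, phi x = -1.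
Proof. by have [x /negbTE tr] := trace2_neq0; exists x; rewrite /phi tr. Qed.

Lemma phi0 : phi 0 = 1.
Proof.
by rewrite /phi /trace2 big1 ?eqxx // => i _; rewrite expr0n expn_eq0.
Qed.

Lemma phi_nondegenerate a : (forall x, phi (a * x) = 1) -> a = 0.
Proof.
move=> triv; apply/eqP; apply/negPn/negP=> a0; have [x] := phi_nontrivial.
by rewrite -(mulVKf a0 x) triv => /eqP; rewrite -addr_eq0 -(natrD _ 1 1) pnatr_eq0.
Qed.
End Trace.

Section Duality.
Variables (V : finZmodType) (gT : finGroupType) (M : {group gT}) (m : V -> gT).
Variable B : V -> V -> algC.
Hypothesis mD : forall u v, m (u + v) = (m u * m v)%g.
Hypothesis m_inj : injective m.
Hypothesis m_mem : forall v, m v \in M.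
Hypothesis mV : forall x, x \in M -> exists v, x = m v.
Hypothesis BDr : forall b u v, B b (u + v) = B b u * B b v.
Hypothesis B0r : forall b, B b 0 = 1.
Hypothesis B_inj : forall b c, (forall v, B b v = B c v) -> b = c.

(** The inverse of m on its image M. *)
Definition coords x : V := odflt 0 [pick v | m v == x].

Lemma coordsK v : coords (m v) = v.
Proof.
by rewrite /coords; case: pickP => [u /eqP/m_inj|/(_ v)] //=; rewrite eqxx.
Qed.

Lemma B_repr b : mx_repr M (fun x => (B b (coords x))%:M : 'M_1).
Proof.
have m_zero : m 0 = 1%g by apply: (mulgI (m 0)); rewrite -mD addr0 mulg1.
split; first by rewrite -m_zero coordsK B0r.
by move=> _ _ /mV[u ->] /mV[v ->]; rewrite -mD !coordsK BDr scalar_mxM.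
Qed.

Definition dual_cfun b := cfRepr (MxRepresentation (B_repr b)).

Lemma dual_cfunE b v : dual_cfun b (m v) = B b v.
Proof.
by rewrite cfunE m_mem /= coordsK mulr1n mxtrace_scalar.
Qed.

Lemma dual_cfun_lin b : dual_cfun b \is a linear_char.
Proof. by rewrite qualifE /= cfRepr_char cfRepr1 eqxx. Qed.

(** B makes V its own dual, and m carries this over to M. *)
Definition dual b : Iirr M := cfIirr (dual_cfun b).

Lemma dual_lin b : 'chi_(dual b) \is a linear_char.
Proof. by rewrite cfIirrE ?lin_char_irr ?dual_cfun_lin. Qed.

Lemma dualE b v : 'chi_(dual b) (m v) = B b v.
Proof. by rewrite cfIirrE ?dual_cfunE // lin_char_irr ?dual_cfun_lin. Qed.

Lemma dual_inj : injective dual.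
Proof. by move=> b c bc; apply: B_inj => v; rewrite -!dualE bc. Qed.

(** There are as many irreducible characters as elements, since M is abelian. *)
Lemma dual_surj j : exists b, j = dual b.
Proof.
have abM: abelian M.
  apply/centsP=> _ /mV[u ->] _ /mV[v ->].
  by rewrite /commute -!mD addrC.
have cardI : #|Iirr M| = #|V|.
  rewrite (card_Iirr_abelian abM) -cardsT -(card_imset _ m_inj); apply: eq_card => x.
  by apply/idP/imsetP=> [/mV[v ->]|[v _ ->]]; [exists v | apply: m_mem].
have [g gK dualK] := inj_card_bij dual_inj (eq_leq cardI).
by exists (g j).
Qed.

End Duality.

(** * The group X_S in coordinates *)

HB.instance Definition _ (U V : finZmodType) := GRing.Zmodule.on (U * V)%type.

(** The labels of the abelian normal subgroup M, the central ones last. *)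
Definition labM : seq nat := [:: 5; 6; 7; 9; 8; 10; 11; 16]%N.

Lemma comm_rootsM : all (fun i => all (fun j => comm_rootsS i j == [::]) labM) labM.
Proof. by vm_compute. Qed.

(** How the four simple root subgroups act on M by conjugation. *)
Lemma comm_roots_conj :
  ((comm_rootsS 5 1 = [::]) * (comm_rootsS 6 1 = [:: (8, 1, 1)]%N)
 * (comm_rootsS 7 1 = [::]) * (comm_rootsS 9 1 = [:: (11, 1, 1)]%N)
 * (comm_rootsS 8 1 = [::]) * (comm_rootsS 10 1 = [::])
 * (comm_rootsS 11 1 = [::]) * (comm_rootsS 16 1 = [::])
 * (comm_rootsS 5 2 = [::]) * (comm_rootsS 6 2 = [::])
 * (comm_rootsS 7 2 = [:: (10, 1, 1); (16, 2, 1)]%N) * (comm_rootsS 9 2 = [::])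
 * (comm_rootsS 8 2 = [::]) * (comm_rootsS 10 2 = [::])
 * (comm_rootsS 11 2 = [::]) * (comm_rootsS 16 2 = [::])
 * (comm_rootsS 5 3 = [:: (8, 1, 1); (11, 1, 2)]%N) * (comm_rootsS 6 3 = [::])
 * (comm_rootsS 7 3 = [::]) * (comm_rootsS 9 3 = [::])
 * (comm_rootsS 8 3 = [::]) * (comm_rootsS 10 3 = [::])
 * (comm_rootsS 11 3 = [::]) * (comm_rootsS 16 3 = [::])
 * (comm_rootsS 5 4 = [::]) * (comm_rootsS 6 4 = [:: (10, 1, 1)]%N)
 * (comm_rootsS 7 4 = [::]) * (comm_rootsS 9 4 = [:: (16, 1, 2)]%N)
 * (comm_rootsS 8 4 = [::]) * (comm_rootsS 10 4 = [::])
 * (comm_rootsS 11 4 = [::]) * (comm_rootsS 16 4 = [::]))%type.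
Proof. by do !split; vm_compute. Qed.

Lemma comm_roots_simple :
  ((comm_rootsS 1 2 = [:: (5, 1, 1)]%N) * (comm_rootsS 2 3 = [:: (6, 1, 1); (9, 1, 2)]%N)
 * (comm_rootsS 3 4 = [:: (7, 1, 1)]%N) * (comm_rootsS 1 3 = [::])
 * (comm_rootsS 1 4 = [::]) * (comm_rootsS 2 4 = [::]))%type.
Proof. by do !split; vm_compute. Qed.

Section QuotientGroup.

Variables (F : finFieldType) (f : nat).
Hypotheses (f_gt0 : (0 < f)%N) (cardF : #|F| = (2 ^ f)%N).
Variables (gT : finGroupType) (G : {group gT}) (y : nat -> F -> gT).
Hypothesis yD : forall i t s, i \in posidx -> y i (t + s) = (y i t * y i s)%g.
Hypothesis y_comm : forall i j t s, i \in posidx -> j \in posidx ->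
  (y i t * y j s = y j s * y i t *
     \prod_(z <- comm_rootsS i j) y z.1.1 (t ^+ z.1.2 * s ^+ z.2)%R)%g.
Hypothesis G_prod : G = (\prod_(i <- labSord) [set y i t | t : F])%g :> {set gT}.
Hypothesis cardG : #|G| = (#|F| ^ 12)%N.

Let char2 : 2%N \in [pchar F] := char2F cardF.

Lemma y_zero i : i \in posidx -> y i 0 = 1%g.
Proof. by move=> iP; apply: (mulgI (y i 0)); rewrite -yD // addr0 mulg1. Qed.

Lemma y_conj i j t s : i \in posidx -> j \in posidx ->
  (y j s ^ y i t =
    y j s * \prod_(z <- comm_rootsS j i) y z.1.1 (s ^+ z.1.2 * t ^+ z.2)%R)%g.
Proof. by move=> iP jP; rewrite conjgE y_comm // !mulgA mulVg mul1g. Qed.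

Lemma y_commute i j t s : i \in posidx -> j \in posidx -> comm_rootsS i j = [::] ->
  commute (y i t) (y j s).
Proof. by move=> iP jP cij; rewrite /commute y_comm // cij big_nil mulg1. Qed.

Let V := ((F * F * F * F) * (F * F * F * F))%type.

(** A product of root subgroups as a map on nested pairs, so that additivity passes
from the factors to the product. *)
Definition pairmul (A B : Type) (g : A -> gT) (h : B -> gT) (u : A * B) : gT :=
  (g u.1 * h u.2)%g.

Lemma pairmulD (A B : zmodType) (g : A -> gT) (h : B -> gT) :
    {morph g : a b / a + b >-> (a * b)%g} -> {morph h : a b / a + b >-> (a * b)%g} ->
    (forall a b, commute (g a) (h b)) ->
  {morph pairmul g h : u v / u + v >-> (u * v)%g}.
Proof.
move=> gD hD gh u v; rewrite /pairmul gD hD -!mulgA; congr (_ * _)%g.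
by rewrite !mulgA; congr (_ * _)%g; apply: gh.
Qed.

Lemma pairmul_commute (A B C : Type) (g : A -> gT) (h : B -> gT) (k : C -> gT) :
    (forall a c, commute (g a) (k c)) -> (forall b c, commute (h b) (k c)) ->
  forall u c, commute (pairmul g h u) (k c).
Proof. by move=> gk hk u c; apply/commute_sym/commuteM; apply: commute_sym. Qed.

Lemma commute_pairmul (A B C : Type) (g : A -> gT) (h : B -> gT) (k : C -> gT) :
    (forall c a, commute (k c) (g a)) -> (forall c b, commute (k c) (h b)) ->
  forall c u, commute (k c) (pairmul g h u).
Proof. by move=> kg kh c u; apply: commuteM. Qed.

(** The coordinates of an element of M, in the order 5, 6, 7, 9 for the first half
and 8, 10, 11, 16 for the second. *)
Definition m : V -> gT :=
  pairmul (pairmul (pairmul (pairmul (y 5) (y 6)) (y 7)) (y 9))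
          (pairmul (pairmul (pairmul (y 8) (y 10)) (y 11)) (y 16)).

Lemma labM_pos i : i \in labM -> i \in posidx.
Proof. by move: i; apply/allP; vm_compute. Qed.

Lemma yM_commute i j t s : i \in labM -> j \in labM -> commute (y i t) (y j s).
Proof.
move=> iM jM; apply: y_commute; rewrite ?labM_pos //.
exact/eqP/(allP (allP comm_rootsM i iM)).
Qed.

Lemma mD u v : m (u + v) = (m u * m v)%g.
Proof.
have yMD i : i \in labM -> {morph y i : a b / a + b >-> (a * b)%g}.
  by move=> iM a b; rewrite yD ?labM_pos.
have yC i j : i \in labM -> j \in labM -> forall a b, commute (y i a) (y j b).
  by move=> iM jM a b; apply: yM_commute.
move: u v; rewrite /m.
by do !first [exact: yMD | exact: yC | apply: pairmulD
             | apply: pairmul_commute | apply: commute_pairmul].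
Qed.

(** Rewriting a root element as a value of m turns products in M into sums. *)
Lemma yE : ((forall a, y 5 a = m (a, 0, 0, 0, (0, 0, 0, 0)))
  * (forall a, y 6 a = m (0, a, 0, 0, (0, 0, 0, 0)))
  * (forall a, y 7 a = m (0, 0, a, 0, (0, 0, 0, 0)))
  * (forall a, y 9 a = m (0, 0, 0, a, (0, 0, 0, 0)))
  * (forall a, y 8 a = m (0, 0, 0, 0, (a, 0, 0, 0)))
  * (forall a, y 10 a = m (0, 0, 0, 0, (0, a, 0, 0)))
  * (forall a, y 11 a = m (0, 0, 0, 0, (0, 0, a, 0)))
  * (forall a, y 16 a = m (0, 0, 0, 0, (0, 0, 0, a))))%type.
Proof. by do !split; move=> a; rewrite /m /pairmul /= !y_zero // ?mulg1 ?mul1g. Qed.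

Lemma pair8_eq (u v : V) :
  u.1.1.1.1 = v.1.1.1.1 -> u.1.1.1.2 = v.1.1.1.2 -> u.1.1.2 = v.1.1.2 ->
  u.1.2 = v.1.2 -> u.2.1.1.1 = v.2.1.1.1 -> u.2.1.1.2 = v.2.1.1.2 ->
  u.2.1.2 = v.2.1.2 -> u.2.2 = v.2.2 -> u = v.
Proof.
case: u v => [[[[? ?] ?] ?] [[[? ?] ?] ?]] [[[[? ?] ?] ?] [[[? ?] ?] ?]] /=.
by do 8!move=> ->.
Qed.

Let K4 := (F * F * F * F)%type.

(** What conjugation by x_1(t_1) x_4(t_4) x_2(t_2) x_3(t_3) adds to the coordinates
8, 10, 11, 16 of an element of M with coordinates v along 5, 6, 7, 9; the
parameters t come in the order 1, 4, 2, 3. *)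
Definition shift (t v : K4) : K4 :=
  (t.1.1.1 * v.1.1.2 + t.2 * v.1.1.1, t.1.2 * v.1.2 + t.1.1.2 * v.1.1.2,
   t.1.1.1 * v.2 + t.2 ^+ 2 * v.1.1.1,
   t.1.2 * v.1.2 ^+ 2 + t.1.1.2 ^+ 2 * v.2).

Lemma m_conj_root s v :
  ((m v ^ y 1 s)%g = m (v + (0, shift (s, 0, 0, 0) v.1)))
  * ((m v ^ y 4 s)%g = m (v + (0, shift (0, s, 0, 0) v.1)))
  * ((m v ^ y 2 s)%g = m (v + (0, shift (0, 0, s, 0) v.1)))
  * ((m v ^ y 3 s)%g = m (v + (0, shift (0, 0, 0, s) v.1))).
Proof.
case: v => [[[[v5 v6] v7] v9] [[[v8 v10] v11] v16]].
do !split; rewrite {1}/m /pairmul /= !conjMg !y_conj // !comm_roots_conj;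
  rewrite !big_cons !big_nil /= !mulg1 !yE -!mD; congr m;
  by apply: pair8_eq; rewrite /shift /=; ring.
Qed.

(** The normal form of the elements of X_S. *)
Definition el (t : K4) (v : V) : gT :=
  (y 1 t.1.1.1 * y 4 t.1.1.2 * y 2 t.1.2 * y 3 t.2 * m v)%g.

Lemma m_conj_el t w v : (m v ^ el t w)%g = m (v + (0, shift t v.1)).
Proof.
have mJ u : (m u ^ m w)%g = m u by rewrite conjgE -mD addrC mD mulKg.
rewrite /el; move: (m w) mJ => n mJ.
rewrite !conjgM !m_conj_root mJ.
by congr m; apply: pair8_eq; rewrite /shift /=; ring.
Qed.

Lemma el_surj g : g \in G -> exists t v, g = el t v.
Proof.
rewrite G_prod !big_cons big_nil mulg1.
case/mulsgP=> _ h /imsetP[t1 _ ->] + ->; case/mulsgP=> _ {}h /imsetP[t4 _ ->] + ->.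
case/mulsgP=> _ {}h /imsetP[t2 _ ->] + ->; case/mulsgP=> _ {}h /imsetP[t3 _ ->] + ->.
case/mulsgP=> _ {}h /imsetP[v5 _ ->] + ->; case/mulsgP=> _ {}h /imsetP[v6 _ ->] + ->.
case/mulsgP=> _ {}h /imsetP[v7 _ ->] + ->; case/mulsgP=> _ {}h /imsetP[v9 _ ->] + ->.
case/mulsgP=> _ {}h /imsetP[v8 _ ->] + ->; case/mulsgP=> _ {}h /imsetP[v10 _ ->] + ->.
case/mulsgP=> _ _ /imsetP[v11 _ ->] /imsetP[v16 _ ->] ->.
exists (t1, t4, t2, t3), (v5, v6, v7, v9, (v8, v10, v11, v16)).
by rewrite /el /m /pairmul /= !mulgA.
Qed.

Lemma labSord_pos : {subset labSord <= posidx}.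
Proof. by apply/allP; vm_compute. Qed.

Lemma y_in i t : i \in labSord -> y i t \in G.
Proof.
move=> iS; have := root_set_sub_prod yD labSord_pos iS.
by rewrite /root_prod -G_prod => /subsetP; apply; apply: imset_f.
Qed.

Lemma m_in v : m v \in G.
Proof. by rewrite /m /pairmul !groupM ?y_in. Qed.

Lemma el_in t v : el t v \in G.
Proof. by rewrite /el !groupM ?m_in ?y_in. Qed.

(** A surjection between finite sets of the same size. *)
Lemma el_inj : injective (fun u : K4 * V => el u.1 u.2).
Proof.
have im_el: (fun u : K4 * V => el u.1 u.2) @: [set: K4 * V] = G.
  apply/setP=> g; apply/imsetP/idP=> [[u _ ->]|/el_surj[t [v ->]]].
    exact: el_in.
  by exists (t, v).
have /imset_injP inj: #|(fun u : K4 * V => el u.1 u.2) @: [set: K4 * V]|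
    == #|[set: K4 * V]|.
  by rewrite im_el cardG cardsT !card_prod !expnS expn0; apply/eqP; ring.
by move=> u v; apply: inj; rewrite inE.
Qed.

Lemma m_zero : m 0 = 1%g.
Proof. by apply: (mulgI (m 0)); rewrite -mD addr0 mulg1. Qed.

Lemma el0 v : el 0 v = m v.
Proof. by rewrite /el /= !y_zero // !mul1g. Qed.

Lemma m_inj : injective m.
Proof. by move=> u v; rewrite -!el0 => /(@el_inj (0, u) (0, v))[]. Qed.

Lemma m_group_set : group_set (m @: [set: V]).
Proof.
apply/group_setP; split; first by apply/imsetP; exists 0; rewrite ?m_zero.
by move=> _ _ /imsetP[u _ ->] /imsetP[v _ ->]; rewrite -mD imset_f.
Qed.

Definition M := Group m_group_set.

Lemma m_mem v : m v \in M. Proof. exact: imset_f. Qed.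

Lemma mem_M x : x \in M -> exists v, x = m v.
Proof. by case/imsetP=> v _ ->; exists v. Qed.

Lemma M_normal : (M <| G)%g.
Proof.
apply/normalP; split; first by apply/subsetP=> _ /mem_M[v ->]; apply: m_in.
move=> _ /el_surj[t [w ->]]; apply/eqP; rewrite eqEcard cardJg leqnn andbT.
apply/subsetP=> _ /imsetP[_ /mem_M[v ->] ->]; rewrite m_conj_el; exact: m_mem.
Qed.

Lemma cardM : #|M| = (#|F| ^ 8)%N.
Proof.
by rewrite /= (card_imset _ m_inj) cardsT !card_prod !expnS expn0; ring.
Qed.

Lemma indexGM : #|G : M|%g = (#|F| ^ 4)%N.
Proof.
rewrite -divgS ?(normal_sub M_normal) // cardG cardM (expnD _ 4 8) mulnK //.
by rewrite expn_gt0 (ltnW (finNzRing_gt1 _)).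
Qed.

(** * The characters of M and their inertia groups *)

Local Notation ph := (phi f).

Definition dot4 (b v : K4) : F :=
  b.1.1.1 * v.1.1.1 + b.1.1.2 * v.1.1.2 + b.1.2 * v.1.2 + b.2 * v.2.

Definition dot (b v : V) : F := dot4 b.1 v.1 + dot4 b.2 v.2.

Definition pairing (b v : V) : algC := ph (dot b v).

Lemma pairingD b u v : pairing b (u + v) = pairing b u * pairing b v.
Proof.
by rewrite /pairing -(phiD f_gt0 cardF); congr phi; rewrite /dot /dot4 /=; ring.
Qed.

Lemma pairing0 b : pairing b 0 = 1.
Proof.
rewrite /pairing (_ : dot b 0 = 0) ?phi0 //.
by rewrite /dot /dot4 /=; ring.
Qed.

(** Evaluating phi along each coordinate axis, by nondegeneracy. *)
Lemma pairing_inj b c : (forall v, pairing b v = pairing c v) -> b = c.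
Proof.
move=> eq_bc; have triv v : ph (dot (b - c) v) = 1.
  have -> : dot (b - c) v = dot b v + dot c v.
    by rewrite -[dot c v](oppr_pchar2 char2) /dot /dot4 /=; ring.
  rewrite (phiD f_gt0 cardF) -[ph (dot b v)]/(pairing b v) eq_bc.
  by case: (phi_pm1 f (dot c v)) => e; rewrite /pairing e ?mulrNN mulr1.
apply/eqP; rewrite -subr_eq0; apply/eqP.
apply: pair8_eq; apply: (phi_nondegenerate f_gt0 cardF) => x.
- by rewrite -(triv (x, 0, 0, 0, (0, 0, 0, 0))); congr phi; rewrite /dot /dot4 /=; ring.
- by rewrite -(triv (0, x, 0, 0, (0, 0, 0, 0))); congr phi; rewrite /dot /dot4 /=; ring.
- by rewrite -(triv (0, 0, x, 0, (0, 0, 0, 0))); congr phi; rewrite /dot /dot4 /=; ring.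
- by rewrite -(triv (0, 0, 0, x, (0, 0, 0, 0))); congr phi; rewrite /dot /dot4 /=; ring.
- by rewrite -(triv (0, 0, 0, 0, (x, 0, 0, 0))); congr phi; rewrite /dot /dot4 /=; ring.
- by rewrite -(triv (0, 0, 0, 0, (0, x, 0, 0))); congr phi; rewrite /dot /dot4 /=; ring.
- by rewrite -(triv (0, 0, 0, 0, (0, 0, x, 0))); congr phi; rewrite /dot /dot4 /=; ring.
- by rewrite -(triv (0, 0, 0, 0, (0, 0, 0, x))); congr phi; rewrite /dot /dot4 /=; ring.
Qed.

Definition psi (b : V) : Iirr M := dual mD m_inj mem_M pairingD pairing0 b.

Lemma psiE b v : 'chi_(psi b) (m v) = pairing b v.
Proof. by apply: dualE => u; apply: m_mem. Qed.

Lemma psi_lin b : 'chi_(psi b) \is a linear_char.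
Proof. exact: dual_lin. Qed.

Lemma psi_inj : injective psi.
Proof. by apply: dual_inj => [u|]; [apply: m_mem | apply: pairing_inj]. Qed.

Lemma psi_surj j : exists b, j = psi b.
Proof. by apply: dual_surj => [u|]; [apply: m_mem | apply: pairing_inj]. Qed.

(** Conjugation multiplies psi_b by phi of the pairing of the shift with the central
coordinates of b. *)
Lemma inertiaP b t w :
  reflect (forall v, ph (dot4 b.2 (shift t v)) = 1) (el t w \in 'I_G['chi_(psi b)])%g.
Proof.
have psiJ v : 'chi_(psi b) (m v ^ el t w)%g
    = 'chi_(psi b) (m v) * ph (dot4 b.2 (shift t v.1)).
  rewrite m_conj_el !psiE pairingD; congr (_ * phi f _).
  by rewrite /dot /dot4 /=; ring.
have nMel : el t w \in 'N(M)%g by rewrite (subsetP (normal_norm M_normal)) ?el_in.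
rewrite in_setI el_in andTb; apply: (iffP idP) => [inv v | fix_t].
  have := inertia_valJ (m (v, 0)) inv; rewrite psiJ -[RHS]mulr1.
  by apply/mulfI/lin_char_neq0/m_mem/psi_lin.
rewrite inE nMel; apply/eqP/cfun_inP=> x Mx; rewrite cfConjgE //.
have: (x ^ (el t w)^-1)%g \in M by rewrite memJ_norm ?groupV.
case/mem_M=> v def_v; rewrite def_v -[x](conjgKV (el t w)) def_v psiJ.
by rewrite fix_t mulr1.
Qed.

(** The characters psi_b that are nontrivial on X_8, X_10, X_11 and X_16. *)
Definition nontrivialZ (b : V) :=
  [&& b.2.1.1.1 != 0, b.2.1.1.2 != 0, b.2.1.2 != 0 & b.2.2 != 0].

(** The nonzero parameters t_i of the elements that fix psi_b. *)
Definition fix2 (b : V) := b.2.2 / b.2.1.1.2 ^+ 2.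
Definition fix3 (b : V) := b.2.1.1.1 / b.2.1.2.
Definition fix4 (b : V) := b.2.1.1.2 * b.2.1.2 / (b.2.1.1.1 * b.2.2).
Definition fix1 (b : V) := b.2.1.1.2 * fix4 b / b.2.1.1.1.

(** The parameters t_2 and t_3 take two values each, independently, whereas t_1 and
t_4 determine each other. *)
Definition stab (b : V) : {set F * F * F * F} :=
  setX (setX [set (0, 0); (fix1 b, fix4 b)] [set 0; fix2 b]) [set 0; fix3 b].

Lemma fix_neq0 b : nontrivialZ b ->
  [/\ fix1 b != 0, fix2 b != 0, fix3 b != 0 & fix4 b != 0].
Proof.
case/and4P=> b8 b10 b11 b16.
by rewrite /fix1 /fix2 /fix3 /fix4; split;
   rewrite ?(mulf_neq0, invr_neq0, expf_neq0).
Qed.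

Lemma quadratic_eq0 (a b x : F) : a != 0 ->
  (a * x ^+ 2 + b * x == 0) = (x \in [set 0; b / a]).
Proof.
move=> a0; have -> : a * x ^+ 2 + b * x = a * (x * (x - b / a)).
  by rewrite -[b / a in RHS](oppr_pchar2 char2); field.
by rewrite !inE !mulf_eq0 (negbTE a0) subr_eq0.
Qed.

(** The second equation gives t_1 in terms of t_4; the fourth one is then quadratic
in t_4, like the two others in t_3 and t_2. *)
Lemma stab_eqs b t1 t4 t2 t3 : nontrivialZ b ->
  ((t1, t4, t2, t3) \in stab b) =
  [&& b.2.1.2 * t3 ^+ 2 + b.2.1.1.1 * t3 == 0,
      b.2.1.1.1 * t1 + b.2.1.1.2 * t4 == 0,
      b.2.1.1.2 ^+ 2 * t2 ^+ 2 + b.2.2 * t2 == 0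
    & b.2.1.2 * t1 + b.2.2 * t4 ^+ 2 == 0].
Proof.
case/and4P; rewrite /stab /fix1 /fix2 /fix3 /fix4.
move: b.2.1.1.1 b.2.1.1.2 b.2.1.2 b.2.2 => b8 b10 b11 b16 nz8 nz10 nz11 nz16.
rewrite !in_setX /= !quadratic_eq0 ?expf_neq0 // andbC; congr (_ && _).
rewrite [LHS]andbC [RHS]andbCA; congr (_ && _).
have -> : (b8 * t1 + b10 * t4 == 0) = (t1 == b10 * t4 / b8).
  rewrite -[t1 == _]subr_eq0 -[b10 * _ / _](oppr_pchar2 char2) opprK.
  by rewrite -[RHS](inj_eq (mulfI nz8)) mulr0; congr (_ == _); field.
case: eqP => [->|ne_t1].
  have -> : b11 * (b10 * t4 / b8) + b16 * t4 ^+ 2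
          = b16 * t4 ^+ 2 + (b10 * b11 / b8) * t4 by field.
  rewrite quadratic_eq0 // !inE !xpair_eqE.
  have -> : b10 * b11 / b8 / b16 = b10 * b11 / (b8 * b16) by rewrite invfM !mulrA.
  have [->|nz4] := eqVneq t4 0; first by rewrite mulr0 mul0r eqxx.
  by have [->|_] := eqVneq t4 (b10 * b11 / (b8 * b16)); rewrite !andbF ?eqxx.
apply/negbTE/negP; rewrite !inE !xpair_eqE.
by case/orP=> /andP[/eqP t1E /eqP t4E]; apply: ne_t1; rewrite t1E t4E ?mulr0 ?mul0r.
Qed.

Lemma phi_sqrD (u w : F) : ph (u + w) = ph (u ^+ 2 + w).
Proof. by rewrite !(phiD f_gt0 cardF) (phi_sqr f_gt0 cardF). Qed.

Lemma sqr_surj (z : F) : exists x, z = x ^+ 2.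
Proof.
by exists (z ^+ (2 ^ f.-1)); rewrite -exprM -expnSr prednK // -cardF expf_card.
Qed.

(** Collecting the coefficients of the coordinates of v gives the four equations
of [stab_eqs]. *)
Lemma stabP b t : nontrivialZ b ->
  reflect (forall v, ph (dot4 b.2 (shift t v)) = 1) (t \in stab b).
Proof.
case: t => [[[t1 t4] t2] t3] gb; rewrite stab_eqs //.
have nd := phi_nondegenerate f_gt0 cardF.
apply: (iffP and4P) => [[/eqP e5 /eqP e6 /eqP e7 /eqP e9] v | triv].
  have -> : dot4 b.2 (shift (t1, t4, t2, t3) v)
     = v.1.1.1 * (b.2.1.2 * t3 ^+ 2 + b.2.1.1.1 * t3)
     + v.1.1.2 * (b.2.1.1.1 * t1 + b.2.1.1.2 * t4)
     + v.2 * (b.2.1.2 * t1 + b.2.2 * t4 ^+ 2)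
     + (b.2.1.1.2 * t2 * v.1.2 + b.2.2 * t2 * v.1.2 ^+ 2).
    by rewrite /dot4 /shift /=; ring.
  (* squaring the first term inside phi makes both terms multiples of v_7^2 *)
  rewrite e5 e6 e9 !mulr0 !add0r phi_sqrD.
  have -> : (b.2.1.1.2 * t2 * v.1.2) ^+ 2 + b.2.2 * t2 * v.1.2 ^+ 2
     = (b.2.1.1.2 ^+ 2 * t2 ^+ 2 + b.2.2 * t2) * v.1.2 ^+ 2 by ring.
  by rewrite e7 mul0r phi0.
split; apply/eqP; apply: nd => x.
- rewrite -(triv (x, 0, 0, 0)); congr phi; rewrite /dot4 /shift /=; ring.
- rewrite -(triv (0, x, 0, 0)); congr phi; rewrite /dot4 /shift /=; ring.
(* the coefficient of v_7 only sees squares, which exhaust F *)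
- have [z ->] := sqr_surj x; rewrite -(triv (0, 0, z, 0)).
  rewrite (_ : dot4 _ _ = b.2.1.1.2 * t2 * z + b.2.2 * t2 * z ^+ 2).
    by rewrite phi_sqrD; congr phi; ring.
  by rewrite /dot4 /shift /=; ring.
- rewrite -(triv (0, 0, 0, x)); congr phi; rewrite /dot4 /shift /=; ring.
Qed.

Lemma card_stab b : nontrivialZ b -> #|stab b| = 8.
Proof.
case/fix_neq0=> f1 f2 f3 f4; rewrite !cardsX !cards2.
by rewrite xpair_eqE ![0 == _]eq_sym (negbTE f1) f2 f3.
Qed.

Lemma inertia_stab b t w : nontrivialZ b ->
  (el t w \in 'I_G['chi_(psi b)])%g = (t \in stab b).
Proof. by move=> gb; apply/inertiaP/stabP. Qed.

Lemma card_inertia b : nontrivialZ b -> #|'I_G['chi_(psi b)]%g| = (8 * #|F| ^ 8)%N.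
Proof.
move=> gb; pose E := setX (stab b) [set: V].
have -> : 'I_G['chi_(psi b)]%g = [set el u.1 u.2 | u in E] :> {set gT}.
  apply/setP=> g; apply/idP/imsetP=> [gI|[[t w] /setXP[/= tS _] ->]]; last first.
    by rewrite inertia_stab.
  have [t [w def_g]] := el_surj (subsetP (Inertia_sub _ _) g gI).
  by exists (t, w) => //; rewrite inE /= -(inertia_stab t w gb) -def_g gI inE.
rewrite (card_imset _ el_inj) cardsX card_stab // cardsT !card_prod.
by rewrite !expnS expn0; ring.
Qed.

Lemma index_inertia_M b : nontrivialZ b -> #|'I_G['chi_(psi b)] : M|%g = 8%N.
Proof.
move=> gb; rewrite -divgS; last exact: sub_Inertia (normal_sub M_normal).
by rewrite card_inertia // cardM mulnK // expn_gt0 (ltnW (finNzRing_gt1 _)).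
Qed.

Lemma index_inertia b : nontrivialZ b ->
  #|G : 'I_G['chi_(psi b)]|%g%:R = #|F|%:R ^+ 4 / 8%:R :> algC.
Proof.
move=> gb; apply: (canRL (mulfK _)); first by rewrite pnatr_eq0.
rewrite -natrM -natrX; congr _%:R; apply/eqP.
have := Lagrange_index (Inertia_sub G 'chi_(psi b))
                       (sub_Inertia 'chi_(psi b) (normal_sub M_normal)).
by rewrite index_inertia_M // indexGM => ->.
Qed.

(** * Degrees over the characters of M *)

Lemma commg_eq (x z w : gT) : (x * z = z * x * w -> [~ x, z] = w)%g.
Proof. by move=> xz; rewrite commgEl conjgE xz -!mulgA !mulKg. Qed.

Lemma der1_gen_sub (A : {set gT}) (K : {group gT}) : A \subset 'N(K)%g ->
  {in A &, forall x z, [~ x, z]%g \in K} -> (<<A>>^`(1) \subset K)%g.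
Proof.
move=> nKA cA; apply: der1_min; first by rewrite gen_subG.
rewrite quotient_gen // abelian_gen /abelian quotient_cents2 // gen_subG.
by apply/subsetP=> _ /imset2P[x z Ax Az ->]; apply: cA.
Qed.

(** Together with M, these three elements generate the inertia group of psi_b. *)
Definition gen1 b := (y 1 (fix1 b) * y 4 (fix4 b))%g.
Definition gen2 b := y 2 (fix2 b).
Definition gen3 b := y 3 (fix3 b).

Lemma comm12 b :
  [~ gen1 b, gen2 b]%g = m (fix1 b * fix2 b, 0, 0, 0, (0, 0, 0, 0)).
Proof.
have y42: commute (y 4 (fix4 b)) (y 2 (fix2 b)).
  by apply/commute_sym/y_commute; rewrite ?comm_roots_simple.
have y54 s: commute (y 5 s) (y 4 (fix4 b)).
  by apply: y_commute; rewrite ?comm_roots_conj.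
have y12 := y_comm (fix1 b) (fix2 b) (isT : 1%N \in posidx) (isT : 2%N \in posidx).
rewrite comm_roots_simple big_seq1 /= !expr1 in y12.
apply: commg_eq; rewrite /gen1 /gen2 -yE -mulgA y42 mulgA y12 -!mulgA.
by do 2!congr (_ * _)%g; apply: y54.
Qed.

Lemma comm23 b :
  [~ gen2 b, gen3 b]%g = m (0, fix2 b * fix3 b, 0, fix2 b * fix3 b ^+ 2, (0, 0, 0, 0)).
Proof.
apply: commg_eq; rewrite /gen2 /gen3 y_comm // comm_roots_simple !big_cons big_nil /=.
rewrite !expr1 mulg1 !yE -mD; congr (_ * m _)%g.
by apply: pair8_eq; rewrite /=; ring.
Qed.

Lemma comm31 b :
  [~ gen3 b, gen1 b]%g = m (0, 0, fix3 b * fix4 b, 0, (0, 0, 0, 0)).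
Proof.
have y31: commute (y 3 (fix3 b)) (y 1 (fix1 b)).
  by apply/commute_sym/y_commute; rewrite ?comm_roots_simple.
have y34 := y_comm (fix3 b) (fix4 b) (isT : 3%N \in posidx) (isT : 4%N \in posidx).
rewrite comm_roots_simple big_seq1 /= !expr1 in y34.
by apply: commg_eq; rewrite /gen1 /gen3 -yE mulgA y31 -mulgA y34 !mulgA.
Qed.

Definition gens b : {set gT} := M :|: [set gen1 b; gen2 b; gen3 b].

Lemma gen_el b : [/\ gen1 b = el (fix1 b, fix4 b, 0, 0) 0,
  gen2 b = el (0, 0, fix2 b, 0) 0 & gen3 b = el (0, 0, 0, fix3 b) 0].
Proof. by rewrite /el /= m_zero !y_zero // !mulg1 !mul1g. Qed.

Lemma gens_inertia b : nontrivialZ b -> gens b \subset 'I_G['chi_(psi b)]%g.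
Proof.
move=> gb; have [e1 e2 e3] := gen_el b.
rewrite subUset sub_Inertia ?(normal_sub M_normal) //=.
apply/subsetP=> g /setUP[/set2P[]->|/set1P->]; rewrite ?e1 ?e2 ?e3 inertia_stab //;
  by rewrite !inE /= !eqxx ?orbT.
Qed.

Lemma inertia_gen b : nontrivialZ b -> 'I_G['chi_(psi b)]%g = <<gens b>>%g.
Proof.
move=> gb; apply/eqP; rewrite eqEsubset gen_subG gens_inertia // andbT.
apply/subsetP=> g gI; have [t [w def_g]] := el_surj (subsetP (Inertia_sub _ _) g gI).
have gM v : m v \in <<gens b>>%g by rewrite mem_gen // inE m_mem.
have ggen x : x \in [set gen1 b; gen2 b; gen3 b] -> x \in <<gens b>>%g.
  by move=> xg; rewrite mem_gen // inE xg orbT.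
move: gI; rewrite def_g inertia_stab // !inE.
case: t {def_g} => [[[t1 t4] t2] t3] /andP[/andP[/= t14 t2E] t3E].
have t14M: (y 1 t1 * y 4 t4)%g \in <<gens b>>%g.
  case/orP: t14 => /eqP[-> ->]; first by rewrite !y_zero // mulg1 group1.
  by apply: ggen; rewrite !inE eqxx.
have t2M: y 2 t2 \in <<gens b>>%g.
  case/orP: t2E => /eqP->; first by rewrite y_zero // group1.
  by apply: ggen; rewrite !inE eqxx orbT.
have t3M: y 3 t3 \in <<gens b>>%g.
  case/orP: t3E => /eqP->; first by rewrite y_zero // group1.
  by apply: ggen; rewrite !inE eqxx orbT.
exact: groupM (groupM (groupM t14M t2M) t3M) (gM w).
Qed.

(** The derived subgroup is controlled by commutators of generators. *)
Lemma inertia_der1_sub b (K : {group gT}) : nontrivialZ b ->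
    'I_G['chi_(psi b)]%g \subset 'N(K)%g ->
    (forall x g, x \in M -> g \in 'I_G['chi_(psi b)]%g -> [~ x, g]%g \in K) ->
    [/\ [~ gen1 b, gen2 b]%g \in K, [~ gen2 b, gen3 b]%g \in K
      & [~ gen3 b, gen1 b]%g \in K] ->
  ('I_G['chi_(psi b)]^`(1) \subset K)%g.
Proof.
move=> gb nKT cMT [c12 c23 c31]; rewrite inertia_gen //.
have Tg x : x \in gens b -> x \in 'I_G['chi_(psi b)]%g.
  exact: (subsetP (gens_inertia gb)).
apply: der1_gen_sub => [|x z]; first by rewrite (subset_trans (gens_inertia gb)).
have sym u v : [~ v, u]%g \in K -> [~ u, v]%g \in K by rewrite -invg_comm groupV.
case/setUP=> [Mx /Tg|xg]; first exact: cMT.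
case/setUP=> [Mz|zg].
  by apply/sym/cMT => //; apply: Tg; rewrite inE xg orbT.
have one u : [~ u, u]%g \in K by rewrite commgg group1.
by move: xg zg; rewrite !inE -!orbA => /or3P[] /eqP-> /or3P[] /eqP->;
   rewrite ?one //; apply: sym.
Qed.

Lemma inertia_der1_M b : nontrivialZ b -> ('I_G['chi_(psi b)]^`(1) \subset M)%g.
Proof.
move=> gb; have nMT: 'I_G['chi_(psi b)]%g \subset 'N(M)%g.
  exact: subset_trans (Inertia_sub _ _) (normal_norm M_normal).
apply: inertia_der1_sub => //; last by rewrite comm12 comm23 comm31 !m_mem.
move=> x g Mx /(subsetP nMT) nMg.
by rewrite commgEl groupM ?groupV // memJ_norm.
Qed.

(** The values of psi_b at the three commutators of [comm12], [comm23], [comm31].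
They form an alternating form on T/M with values in the prime field; this is the
case where it vanishes, so that psi_b extends to T. *)
Definition untwisted (b : V) :=
  [&& ph (b.1.1.1.1 * (fix1 b * fix2 b)) == 1,
      ph (b.1.1.1.2 * (fix2 b * fix3 b) + b.1.2 * (fix2 b * fix3 b ^+ 2)) == 1
    & ph (b.1.1.2 * (fix3 b * fix4 b)) == 1].

(** Modulo the kernel of psi_b the subgroup M is central in T, so only the
commutators of the three other generators matter. *)
Lemma inertia_der1_ker b : nontrivialZ b ->
  ('I_G['chi_(psi b)]^`(1) \subset cfker 'chi_(psi b))%g = untwisted b.
Proof.
move=> gb; pose T := 'I_G['chi_(psi b)]%G; pose K := cfker 'chi_(psi b).
have memK v : (m v \in K) = (ph (dot b v) == 1).
  by rewrite /K cfkerEirr inE psiE (lin_char1 (psi_lin b)).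
have -> : untwisted b = [&& [~ gen1 b, gen2 b]%g \in K, [~ gen2 b, gen3 b]%g \in K
      & [~ gen3 b, gen1 b]%g \in K].
  rewrite comm12 comm23 comm31 !memK /untwisted; congr (_ && (_ && _));
    by congr (phi f _ == 1); rewrite /dot /dot4 /=; ring.
have nKT: T \subset 'N(K)%g.
  apply/subsetP=> g /setIP[_ Ig]; have nMg := subsetP (norm_inertia _) g Ig.
  by rewrite inE -cfker_conjg // inertiaJ.
apply/idP/and3P=> [sT'K|].
  have Tg x : x \in gens b -> x \in T by apply: (subsetP (gens_inertia gb)).
  by split; apply/(subsetP sT'K)/mem_commg; apply: Tg; rewrite !inE eqxx ?orbT.
apply: inertia_der1_sub => //.
move=> x g /mem_M[v ->] /setIP[_ Ig]; have nMg := subsetP (norm_inertia _) g Ig.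
change ([~ m v, g]%g \in cfker 'chi_(psi b)).
rewrite commgEl cfkerEirr inE (lin_charM (psi_lin b)) ?groupV ?memJ_norm ?m_mem //.
rewrite (lin_charV (psi_lin b)) ?m_mem // (inertia_valJ _ Ig) (lin_char1 (psi_lin b)).
by rewrite mulVf // (lin_char_neq0 (psi_lin b)) ?m_mem.
Qed.

Lemma irr1_over_psi k b : nontrivialZ b -> psi b \in irr_constt ('Res[M] 'chi[G]_k) ->
  'chi_k 1%g = #|F|%:R ^+ 4 / (if untwisted b then 8%:R else 4%:R).
Proof.
move=> gb kb; rewrite (irr1_Clifford M_normal (psi_lin b) kb) ?inertia_der1_M //.
  rewrite index_inertia // inertia_der1_ker //.
  by case: untwisted; [rewrite mulr1 | field].
by rewrite index_inertia_M.
Qed.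

(** The characters of the proposition, in terms of the root elements y. *)
Definition irrZ : {set Iirr G} :=
  [set k : Iirr G | all (fun i => ~~ ([set y i t | t : F] \subset cfker 'chi_k)) labZ].

(** X_i is central, so on X_i the character chi_k is a multiple of phi(c t). *)
Lemma irr_central_root k b i (c : F) (z : F -> V) :
    psi b \in irr_constt ('Res[M] 'chi[G]_k) ->
    (forall t, y i t = m (z t)) -> (forall t, (z t).1 = 0) ->
    (forall t, dot b (z t) = c * t) ->
  ([set y i t | t : F] \subset cfker 'chi_k) = (c == 0).
Proof.
move=> kb yz z1 dotz.
have cent t : m (z t) \in 'C(G)%g.
  apply/centP=> g /el_surj[s [w ->]]; apply/commgP/conjg_fixP.
  rewrite m_conj_el z1; congr m; apply: pair8_eq; rewrite /shift /=; ring.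
have chi_y t : 'chi_k (y i t) = 'chi_k 1%g * ph (c * t).
  by rewrite yz (irr_central M_normal (psi_lin b) kb) ?m_mem // psiE /pairing dotz.
apply/idP/eqP => [/subsetP sXK | c0].
  apply: (phi_nondegenerate f_gt0 cardF) => t.
  have := sXK _ (imset_f (y i) (isT : t \in F)); rewrite cfkerEirr inE chi_y.
  rewrite -[X in _ == X]mulr1 => /eqP; exact/mulfI/irr1_neq0.
apply/subsetP=> _ /imsetP[t _ ->]; rewrite cfkerEirr inE chi_y c0 mul0r phi0 //.
by rewrite mulr1.
Qed.

Lemma irrZ_over_psi k b : psi b \in irr_constt ('Res[M] 'chi[G]_k) ->
  (k \in irrZ) = nontrivialZ b.
Proof.
move=> kb; rewrite inE /= andbT /nontrivialZ.
have root := irr_central_root kb.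
rewrite (root 8%N b.2.1.1.1 (fun t => (0, (t, 0, 0, 0)))) => [|t|//|t]; last 2 first.
- by rewrite yE.
- by rewrite /dot /dot4 /=; ring.
rewrite (root 10%N b.2.1.1.2 (fun t => (0, (0, t, 0, 0)))) => [|t|//|t]; last 2 first.
- by rewrite yE.
- by rewrite /dot /dot4 /=; ring.
rewrite (root 11%N b.2.1.2 (fun t => (0, (0, 0, t, 0)))) => [|t|//|t]; last 2 first.
- by rewrite yE.
- by rewrite /dot /dot4 /=; ring.
rewrite (root 16%N b.2.2 (fun t => (0, (0, 0, 0, t)))) => [//|t|//|t].
  by rewrite yE.
by rewrite /dot /dot4 /=; ring.
Qed.

(** * Counting characters by degree *)

(** The involution h exchanges the part of S where P holds and its complement. *)
Lemma card_half (T : finType) (S : {set T}) (P : pred T) (h : T -> T) :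
    {in S, forall b, h b \in S} -> {in S, forall b, P (h b) = ~~ P b} ->
    {in S, forall b, h (h b) = b} ->
  #|S| = (2 * #|[set b in S | P b]|)%N.
Proof.
move=> hS hP hh; rewrite -(cardsID [set b | P b] S) mul2n -addnn.
have hinj : {in S &, injective h} by move=> b c /hh {2}<- /hh {2}<- ->.
have -> : S :&: [set b | P b] = [set b in S | P b] by apply/setP=> b; rewrite !inE.
congr (_ + _)%N.
have <- : h @: (S :\: [set b | P b]) = [set b in S | P b].
  apply/setP=> b; apply/imsetP/idP => [[c]|]; rewrite !inE.
    by case/andP=> nPc cS ->; rewrite hS // hP.
  by case/andP=> bS Pb; exists (h b); rewrite ?hh // !inE hS // hP // Pb.
by rewrite card_in_imset // => b c /setDP[bS _] /setDP[cS _]; apply: hinj.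
Qed.

Lemma ph_flip (u u0 k : F) : k != 0 -> ph u0 = -1 ->
  (ph (u + u0 / k * k) == 1) = ~~ (ph u == 1).
Proof.
move=> k0 u0E; rewrite divfK // (phiD f_gt0 cardF) u0E mulrN1.
have neN1: (-1 == 1 :> algC) = false.
  by rewrite eq_sym -subr_eq0 opprK -(natrD _ 1 1) pnatr_eq0.
by case: (phi_pm1 f u) => ->; rewrite ?opprK neN1 ?eqxx.
Qed.

Definition nontrivialZ_set : {set V} := [set b | nontrivialZ b].

Lemma card_nontrivialZ : #|nontrivialZ_set| = ((#|F| - 1) ^ 4 * #|F| ^ 4)%N.
Proof.
pose N : {set F} := [set~ 0].
have -> : nontrivialZ_set = setX [set: K4] (setX (setX (setX N N) N) N).
  by apply/setP=> b; rewrite !inE /nontrivialZ /= !andbA.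
by rewrite !cardsX cardsT !card_prod !cardsC1 !subn1 !expnS !expn0; ring.
Qed.

(** The three conditions halve the set one after the other: translating b_5, b_6 or
b_7 by a suitable amount flips the corresponding sign and leaves the other two
alone, as the parameters [fix1], ..., [fix4] depend on the central coordinates
only. *)
Lemma card_untwisted :
  #|nontrivialZ_set| = (8 * #|[set b in nontrivialZ_set | untwisted b]|)%N.
Proof.
have [u0 u0E] := phi_nontrivial f_gt0 cardF.
have xx (u w : F) : u + w + w = u by rewrite -addrA (addrr_pchar2 char2) addr0.
pose P1 b := ph (b.1.1.1.1 * (fix1 b * fix2 b)) == 1.
pose P2 b :=
  ph (b.1.1.1.2 * (fix2 b * fix3 b) + b.1.2 * (fix2 b * fix3 b ^+ 2)) == 1.
pose P3 b := ph (b.1.1.2 * (fix3 b * fix4 b)) == 1.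
pose h1 (b : V) : V :=
  ((b.1.1.1.1 + u0 / (fix1 b * fix2 b), b.1.1.1.2, b.1.1.2, b.1.2), b.2).
pose h2 (b : V) : V :=
  ((b.1.1.1.1, b.1.1.1.2 + u0 / (fix2 b * fix3 b), b.1.1.2, b.1.2), b.2).
pose h3 (b : V) : V :=
  ((b.1.1.1.1, b.1.1.1.2, b.1.1.2 + u0 / (fix3 b * fix4 b), b.1.2), b.2).
have eta (b : V) : (b.1.1.1.1, b.1.1.1.2, b.1.1.2, b.1.2, b.2) = b.
  by case: b => [[[[? ?] ?] ?] ?].
rewrite (@card_half _ nontrivialZ_set P1 h1); first last.
- by move=> b _; rewrite /h1 /= xx eta.
- move=> b; rewrite inE => /fix_neq0[k1 k2 _ _].
  by rewrite /P1 /h1 /= mulrDl ph_flip // mulf_neq0.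
- by move=> b; rewrite !inE.
rewrite (@card_half _ [set b in nontrivialZ_set | P1 b] P2 h2); first last.
- by move=> b _; rewrite /h2 /= xx eta.
- move=> b; rewrite !inE => /andP[/fix_neq0[_ k2 k3 _] _].
  by rewrite /P2 /h2 /= mulrDl addrAC ph_flip // mulf_neq0.
- by move=> b; rewrite !inE.
rewrite (@card_half _ [set b in [set b in nontrivialZ_set | P1 b] | P2 b] P3 h3); first last.
- by move=> b _; rewrite /h3 /= xx eta.
- move=> b; rewrite !inE => /andP[/andP[/fix_neq0[_ _ k3 k4] _] _].
  by rewrite /P3 /h3 /= mulrDl ph_flip // mulf_neq0.
- by move=> b; rewrite !inE.
rewrite !mulnA; congr (_ * _)%N; apply: eq_card => b.
by rewrite !inE /untwisted -!andbA.
Qed.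

Lemma sum_irr1_psi (A : {set Iirr G}) (P : pred V) :
    (forall k b, psi b \in irr_constt ('Res[M] 'chi[G]_k) -> (k \in A) = P b) ->
  \sum_(k in A) 'chi_k 1%g ^+ 2 = #|F|%:R ^+ 4 * #|[set b | P b]|%:R :> algC.
Proof.
move=> AP; rewrite (sum_irr1_sq (B := psi @: [set b | P b]) (normal_sub M_normal)).
  rewrite indexGM natrX; congr (_ * _).
  rewrite -(card_imset _ psi_inj) -sumr_const; apply: eq_bigr => j /imsetP[b _ ->].
  by rewrite (lin_char1 (psi_lin b)) expr1n.
move=> k j; have [b ->] := psi_surj j => /AP ->.
by rewrite (mem_imset _ _ psi_inj) inE.
Qed.

Definition low_degree : {set Iirr G} :=
  [set k in irrZ | 'chi_k 1%g == #|F|%:R ^+ 4 / 8%:R].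

Lemma F_neq0 : #|F|%:R != 0 :> algC.
Proof. by rewrite pnatr_eq0 -lt0n (ltnW (finNzRing_gt1 _)). Qed.

Lemma low_degree_over_psi k b : psi b \in irr_constt ('Res[M] 'chi[G]_k) ->
  (k \in low_degree) = nontrivialZ b && untwisted b.
Proof.
move=> kb; rewrite inE (irrZ_over_psi kb); case: (boolP (nontrivialZ b)) => //= gb.
rewrite (irr1_over_psi gb kb); case: untwisted; first by rewrite eqxx.
apply/negbTE; rewrite -subr_eq0 -mulrBr mulf_neq0 ?expf_neq0 ?F_neq0 //.
rewrite subr_eq0 (inj_eq invr_inj) eqr_nat //.
Qed.

Lemma high_degree_over_psi k b : psi b \in irr_constt ('Res[M] 'chi[G]_k) ->
  (k \in irrZ :\: low_degree) = nontrivialZ b && ~~ untwisted b.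
Proof.
move=> kb; rewrite in_setD (low_degree_over_psi kb) (irrZ_over_psi kb).
by case: nontrivialZ; rewrite ?andbT.
Qed.

Lemma over_some_psi (k : Iirr G) : exists b, psi b \in irr_constt ('Res[M] 'chi[G]_k).
Proof.
have [j jk] := constt_cfRes_irr M k.
by have [b jb] := psi_surj j; exists b; rewrite -jb.
Qed.

Lemma high_degree k : k \in irrZ :\: low_degree ->
  'chi_k 1%g = #|F|%:R ^+ 4 / 4%:R.
Proof.
have [b kb] := over_some_psi k.
rewrite (high_degree_over_psi kb) => /andP[gb /negbTE ub].
by rewrite (irr1_over_psi gb kb) ub.
Qed.

Lemma card_low_degree : #|low_degree| = (8 * (#|F| - 1) ^ 4)%N.
Proof.
have := sum_irr1_psi low_degree_over_psi.
rewrite (eq_bigr (fun=> (#|F|%:R ^+ 4 / 8%:R) ^+ 2)).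
  rewrite sumr_const => sumE; have := card_untwisted; rewrite card_nontrivialZ.
  have -> : [set b in nontrivialZ_set | untwisted b]
          = [set b | nontrivialZ b && untwisted b].
    by apply/setP=> b; rewrite !inE.
  move/(congr1 (fun n => n%:R : algC)); rewrite !(natrX, natrM) => cardE.
  apply/eqP; rewrite -(eqr_nat algC) !(natrX, natrM); apply/eqP.
  apply: (mulIf (expf_neq0 8 F_neq0)).
  move: sumE; rewrite -[_ *+ #|low_degree|]mulr_natl; move: cardE.
  set n := #|[set _ | _]|%:R; set s := #|low_degree|%:R; set q := #|F|%:R.
  set r := (#|F| - 1)%:R => cardE sumE.
  transitivity (64%:R * (s * (q ^+ 4 / 8%:R) ^+ 2)); first by field.
  rewrite sumE; transitivity (8%:R * q ^+ 4 * (8%:R * n)); first by ring.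
  by rewrite -cardE; ring.
by move=> k; rewrite inE => /andP[_ /eqP->].
Qed.

Lemma card_high_degree : #|irrZ :\: low_degree| = (14 * (#|F| - 1) ^ 4)%N.
Proof.
have := sum_irr1_psi high_degree_over_psi.
rewrite (eq_bigr (fun=> (#|F|%:R ^+ 4 / 4%:R) ^+ 2)).
  rewrite sumr_const => sumE; have := cardsID [set b | untwisted b] nontrivialZ_set.
  have -> : nontrivialZ_set :&: [set b | untwisted b]
          = [set b in nontrivialZ_set | untwisted b].
    by apply/setP=> b; rewrite !inE.
  have -> : nontrivialZ_set :\: [set b | untwisted b]
          = [set b | nontrivialZ b && ~~ untwisted b].
    by apply/setP=> b; rewrite !inE andbC.
  move/(congr1 (muln 8)); rewrite mulnDr -card_untwisted card_nontrivialZ.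
  move/(congr1 (fun n => n%:R : algC)); rewrite natrD !(natrX, natrM) => cardE.
  apply/eqP; rewrite -(eqr_nat algC) !(natrX, natrM); apply/eqP.
  apply: (mulIf (expf_neq0 8 F_neq0)).
  move: sumE; rewrite -[_ *+ #|irrZ :\: low_degree|]mulr_natl; move: cardE.
  set n := #|[set _ | _]|%:R; set s := #|irrZ :\: low_degree|%:R; set q := #|F|%:R.
  set r := (#|F| - 1)%:R => cardE sumE.
  transitivity (16%:R * (s * (q ^+ 4 / 4%:R) ^+ 2)); first by field.
  have cardE' : 8%:R * n = 7%:R * (r ^+ 4 * q ^+ 4).
    (* one eighth is untwisted, seven eighths remain *)
    by apply: (addrI (r ^+ 4 * q ^+ 4)); rewrite cardE; ring.
  rewrite sumE; transitivity (2%:R * q ^+ 4 * (8%:R * n)); first by ring.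
  by rewrite cardE'; ring.
by move=> k /high_degree ->.
Qed.

End QuotientGroup.

(** * The eight families *)

Lemma equal_coloring (T : finType) (S : {set T}) (k n : nat) : #|S| = (k * n)%N ->
  exists2 c : T -> nat, {in S, forall x, (c x < k)%N} &
    forall i, (i < k)%N -> #|[set x in S | c x == i]| = n.
Proof.
elim: k S => [|k IH] S cardS.
  by exists (fun=> 0%N) => // x; rewrite (cards0_eq cardS) inE.
pose A := [set x in take n (enum S)].
have cardA : #|A| = n.
  rewrite cardsE (card_uniqP (take_uniq n (enum_uniq S))) size_takel //.
  by rewrite -cardE cardS mulSn leq_addr.
have sAS : A \subset S by apply/subsetP=> x; rewrite inE => /mem_take; rewrite mem_enum.
have [|c c_lt card_c] := IH (S :\: A).
  by rewrite cardsD (setIidPr sAS) cardS cardA mulSn addKn.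
exists (fun x => if x \in A then k else c x) => [x xS | i].
  by case: ifPn => // xA; rewrite ltnS ltnW // c_lt // inE xA.
rewrite ltnS leq_eqVlt => /predU1P[->|ltik].
  rewrite -[RHS]cardA; apply: eq_card => x; rewrite [LHS]inE.
  case: ifPn => [xA|xA]; first by rewrite eqxx (subsetP sAS).
  apply/negbTE/negP=> /andP[xS /eqP cxk].
  by have := c_lt x; rewrite inE xA xS cxk ltnn => /(_ isT).
rewrite -(card_c i ltik); apply: eq_card => x; rewrite !inE.
by case: ifPn; rewrite ?andbF // eq_sym (ltn_eqF ltik) andbF.
Qed.

Theorem proposition6p3 (f : nat) (hf : (1 <= f)%N)
    (F : finFieldType) (hF : #|F| = (2 ^ f)%N) :
  let q := (2 ^ f)%N in
  exists Fam : 'I_8 -> {set Iirr (XS F)},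
    [/\ F72 F = \bigcup_(i < 8) Fam i,
        forall i j : 'I_8, i != j -> [disjoint Fam i & Fam j],
        #|Fam ord0| = (8 * (q - 1) ^ 4)%N
        /\ (forall c, c \in Fam ord0 ->
              'chi[XS F]_c 1%g = q%:R ^+ 4 / 8%:R)
      & forall i : 'I_8, i != ord0 ->
          #|Fam i| = (2 * (q - 1) ^ 4)%N
          /\ (forall c, c \in Fam i ->
                'chi[XS F]_c 1%g = q%:R ^+ 4 / 4%:R)].
Proof.
move=> q; rewrite /q -hF {q}.
have char2 := char2F hF.
have [y [yD y_comm XS_prod cardXS rootE]] := XS_structure char2.
have F72E : F72 F = irrZ (XS F) y.
  apply/setP=> c; rewrite !inE; apply: eq_in_all => i iZ; rewrite rootE //.
  by move: i iZ; apply/allP; vm_compute.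
have sm_card := card_low_degree hf hF yD y_comm XS_prod cardXS.
have lg_card := card_high_degree hf hF yD y_comm XS_prod cardXS.
have lg_deg := high_degree hf hF yD y_comm XS_prod cardXS.
set A := low_degree (XS F) y in sm_card lg_card lg_deg;
set C := irrZ (XS F) y in F72E lg_card lg_deg.
(* 14 (q - 1)^4 = 7 * (2 (q - 1)^4) *)
have [|col col_lt card_col] := @equal_coloring _ (C :\: A) 7 (2 * (#|F| - 1) ^ 4).
  by rewrite lg_card mulnA.
(* family 0 collects the low degree, the seven others are the colors *)
pose kind (c : Iirr (XS F)) : nat := if c \in A then 0%N else (col c).+1.
pose Fam (i : 'I_8) := [set c in C | kind c == i].
have FamS (i : 'I_8) : i != ord0 -> Fam i = [set c in C :\: A | col c == i.-1].
  rewrite -val_eqE /= => i0; apply/setP=> c; rewrite in_set in_setD /Fam in_set.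
  rewrite -(eqSS (col c)) (prednK (n := i)) ?lt0n // /kind.
  by case: (c \in A); rewrite ?andbF // eq_sym (negbTE i0) andbF.
exists Fam; split.
- rewrite F72E; apply/setP=> c; apply/idP/bigcupP=> [cC | [i _]]; last by case/setIdP.
  have lt8 : (kind c < 8)%N.
    by rewrite /kind; case: ifPn => // cA; rewrite ltnS col_lt // inE cA.
  by exists (Ordinal lt8) => //; rewrite inE cC /=.
- move=> i j ne_ij; rewrite -setI_eq0; apply/eqP/setP=> c; rewrite !inE.
  apply/negbTE/negP=> /andP[/andP[_ /eqP ci] /andP[_ /eqP cj]].
  by case/eqP: ne_ij; apply: val_inj; rewrite /= -ci -cj.
- have -> : Fam ord0 = A.
    apply/setP=> c; rewrite inE /kind; case: (boolP (c \in A)) => cA; last by rewrite andbF.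
    by rewrite eqxx andbT; move: cA; rewrite inE => /andP[].
  by split=> // c; rewrite inE => /andP[_ /eqP].
move=> i i0; rewrite FamS //; split=> [|c /setIdP[cCA _]]; last exact: lg_deg.
apply: card_col; rewrite -ltnS prednK ?ltn_ord // lt0n.
exact: i0.
Qed.
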